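(* Let $K\ge 1$ and let $\boldsymbol{\zeta}=(\zeta^{(1)},\dots,\zeta^{(K)})$ be a family of probability distributions on $\mathcal W_K$, with projection $\boldsymbol\mu=(\mu^{(1)},\dots,\mu^{(K)})$ and generating functions $\phi^{(i)}$ of $\mu^{(i)}$, such that: (A.1) $\boldsymbol\zeta$ is entire; (A.2) for all $j\in[K]$, $\zeta^{(j)}(\emptyset)>0$; (A.3) for all $i\in[K]$, there exists $B_i>0$ such that for all $b_i\ge B_i$ and all $(b_j)_{j\ne i}\in\mathbb R_+^{K-1}$, $$\frac{\partial\phi^{(i)}}{\partial b_i}(b_1,\dots,b_K)\ \ge\ \frac{\phi^{(i)}(b_1,\dots,b_K)}{b_i}.$$ Let $L\ge 1$ and let $\Gamma$ be a real $L\times K$ matrix such that: (B) there exists $\boldsymbol\gamma=(\gamma_1,\dots,\gamma_K)\in(\mathrm{Ker}\,\Gamma)^\perp$ such that $\boldsymbol\gamma\in(\mathbb N^* )^K$ and $\gamma_i=1$ for some $i\in[K]$. Then there exists a critical family $\tilde{\boldsymbol\zeta}$ of probability distributions on $\mathcal W_K$ that is $\Gamma$-equivalent to $\boldsymbol\zeta$. Furthermore, if $\mathrm{rk}(\Gamma)=1$ and $\boldsymbol\zeta$ is irreducible, then this critical family is unique.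
   Context: Notation: $\mathbb N=\{0,1,2,\dots\}$, $\mathbb N^*=\{1,2,\dots\}$, $\mathbb R_+=[0,\infty)$, $[K]=\{1,\dots,K\}$. $\mathcal W_K=\bigcup_{n\ge 0}[K]^n$ is the set of finite words on $[K]$, with $\emptyset$ the empty word. Orthogonality is with respect to the usual scalar product on $\mathbb R^K$. Projection: for $w\in\mathcal W_K$ let $p(w)=(w^{(1)},\dots,w^{(K)})\in\mathbb N^K$, where $w^{(j)}$ is the number of $j$'s in $w$. The projection of $\boldsymbol\zeta$ is the family $\boldsymbol\mu$ of distributions on $\mathbb N^K$ given by $\mu^{(i)}(\mathbf k)=\sum_{w:\,p(w)=\mathbf k}\zeta^{(i)}(w)$. The generating function of $\mu^{(i)}$ is $\phi^{(i)}(s_1,\dots,s_K)=\sum_{\mathbf k\in\mathbb N^K}\mu^{(i)}(\mathbf k)\,s_1^{k_1}\cdots s_K^{k_K}$. $\boldsymbol\zeta$ is entire if every $\phi^{(i)}$ is entire (the series converges on all of $\mathbb C^K$). Mean matrix: $M=(m_{i,j})_{i,j\in[K]}$, $m_{i,j}=\sum_{\mathbf z\in\mathbb N^K} z_j\,\mu^{(i)}(\mathbf z)$. $\boldsymbol\zeta$ is critical if $M$ has spectral radius $1$; irreducible if for all $i,j\in[K]$ there is $p\in\mathbb N^*$ with $(M^p)_{i,j}>0$. BGW trees: a $K$-type plane tree is a rooted ordered (plane) tree each of whose vertices has a type in $[K]$. For $i\in[K]$, the $\boldsymbol\zeta$-BGW tree $\mathcal T^{(i)}$ is the random $K$-type plane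 tree whose root has type $i$ and in which, independently for each vertex, the ordered list of types of the children of a vertex of type $j$ has law $\zeta^{(j)}$. $N_j(T)$ is the number of vertices of type $j$ in $T$. For $\mathbf g\in\mathbb R^L$, $\mathcal T^{(i)}_{\Gamma,\mathbf g}$ denotes $\mathcal T^{(i)}$ conditioned on the event that the tree is finite and $$(\ast)\qquad \Gamma\,(N_1(\mathcal T^{(i)}),\dots,N_K(\mathcal T^{(i)}))^{T}=\mathbf g .$$ $\Gamma$-equivalence: $\boldsymbol\zeta$ and $\tilde{\boldsymbol\zeta}$ are $\Gamma$-equivalent if (i) for all $w\in\mathcal W_K$ and $i\in[K]$, $\zeta^{(i)}(w)=0$ if and only if $\tilde\zeta^{(i)}(w)=0$; and (ii) for all $i\in[K]$ and all $\mathbf g$ such that the conditioning event $(\ast)$ has positive probability for the $\boldsymbol\zeta$-BGW tree, $\mathcal T^{(i)}_{\Gamma,\mathbf g}$ and $\tilde{\mathcal T}^{(i)}_{\Gamma,\mathbf g}$ have the same law, where $\tilde{\mathcal T}^{(i)}_{\Gamma,\mathbf g}$ is the $\tilde{\boldsymbol\zeta}$-BGW tree with root type $i$ under the same conditioning. *)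

(* Defs.v *)
From HB Require Import structures.
From mathcomp Require Import all_boot all_order all_algebra.
From mathcomp Require Import finmap.
From mathcomp Require Import all_classical all_reals all_analysis.
From mathcomp Require Import complex.

Set Implicit Arguments.
Unset Strict Implicit.
Unset Printing Implicit Defensive.

Import Order.TTheory GRing.Theory Num.Theory.
Import numFieldNormedType.Exports.

Local Open Scope classical_set_scope.
Local Open Scope ring_scope.

(* Types are elements of 'I_K; a word is a seq 'I_K.  A family of laws on
   words is a function zeta : 'I_K -> seq 'I_K -> R. *)

Section family.
Variables (R : realType) (K : nat).
Implicit Types zeta : 'I_K -> seq 'I_K -> R.

Definition prob_family zeta : Prop :=
  (forall i w, 0 <= zeta i w) /\
  (forall i, \esum_(w in [set: seq 'I_K]) (zeta i w)%:E = 1%E).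

Definition word_proj (w : seq 'I_K) : {ffun 'I_K -> nat} :=
  [ffun j => count_mem j w].

(* The \sum_(_ \in _) below is over a finite set, so it is never the
   default value of a sum with infinite support. *)
Lemma finite_word_proj_fiber (k : {ffun 'I_K -> nat}) :
  finite_set [set w | word_proj w = k].
Proof.
apply: (@sub_finite_set _ _
  ((fun t : (\sum_j k j).-tuple 'I_K => tval t) @` setT)); last first.
  by apply: finite_image; exact: finite_finset.
move=> w /= <-; have sw : size w == (\sum_j word_proj w j)%N.
  rewrite -sum1_size; under [X in _ == X]eq_bigr do
    rewrite ffunE -sum1_count.
  rewrite (exchange_big_dep xpredT) //=; apply/eqP/eq_bigr => x _.
  by rewrite (big_pred1 x) // => j; rewrite eq_sym.
by exists (Tuple sw).
Qed.

Definition word_law_proj zeta (i : 'I_K) (k : {ffun 'I_K -> nat}) : R :=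
  \sum_(w \in [set w | word_proj w = k]) zeta i w.

(* A power series in several variables converges in the unordered, i.e.
   absolute, sense. *)
Definition entire zeta : Prop :=
  forall (i : 'I_K) (s : 'I_K -> R[i]),
    (\esum_(k in [set: {ffun 'I_K -> nat}])
       (Normc.normc ((word_law_proj zeta i k)%:C%C * \prod_j s j ^+ k j))%:E < +oo)%E.

(* Sum of an absolutely summable real family. *)
Definition rsum (T : choiceType) (f : T -> R) : R :=
  fine (\esum_(x in [set: T]) (Num.max (f x) 0)%:E) -
  fine (\esum_(x in [set: T]) (Num.max (- f x) 0)%:E).

Definition gen_fun zeta (i : 'I_K) (s : 'I_K -> R) : R :=
  rsum (fun k : {ffun 'I_K -> nat} => word_law_proj zeta i k * \prod_j s j ^+ k j).

Definition partial_derivative (f : ('I_K -> R) -> R) (i : 'I_K)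
    (b : 'I_K -> R) : R :=
  derive1 (fun t : R => f (fun j => if j == i then t else b j)) (b i).

Definition superlinear zeta : Prop :=
  forall i : 'I_K, exists2 B : R, 0 < B &
    forall b : 'I_K -> R, B <= b i -> (forall j, j != i -> 0 <= b j) ->
      gen_fun zeta i b / b i <= partial_derivative (gen_fun zeta i) i b.

Definition mean zeta (i j : 'I_K) : \bar R :=
  \esum_(z in [set: {ffun 'I_K -> nat}]) ((z j)%:R * word_law_proj zeta i z)%:E.

(* Meaningful when all the entries are finite, e.g. when zeta is entire;
   [critical] requires it. *)
Definition mean_mx zeta : 'M[R]_K := \matrix_(i, j) fine (mean zeta i j).

Definition spectral_radius (A : 'M[R]_K) : R :=
  sup [set Normc.normc l | l in
    [set l : R[i] | eigenvalue (map_mx (real_complex R) A) l]].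

Definition critical zeta : Prop :=
  (forall i j, (mean zeta i j < +oo)%E) /\ spectral_radius (mean_mx zeta) = 1.

Definition irreducible zeta : Prop :=
  forall i j, exists2 p : nat, (0 < p)%N & 0 < (mean_mx zeta ^+ p) i j.

End family.

Section trees.
Variable K : nat.

(* Possibly infinite K-type plane trees in Ulam-Harris coding: a tree maps a
   vertex to its type and a non-vertex to None.  Vertices are read from the
   vertex up to the root: [::] is the root and n :: u is the child number n
   (from 0) of u. *)
Definition ptree := seq nat -> option 'I_K.

Definition vertices (t : ptree) : set (seq nat) := [set u | t u <> None].

(* Number of vertices of type j; only used for finite trees (it is 0 when
   there are infinitely many such vertices). *)
Definition ntype (t : ptree) (j : 'I_K) : nat :=
  #|` fset_set [set u | t u = Some j] |.

(* The tree with root type i where a vertex u, if it has type j, has x (u, j)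
   as the list of the types of its children. *)
Fixpoint grow (x : seq nat * 'I_K -> seq 'I_K) (i : 'I_K) (u : seq nat)
    : option 'I_K :=
  if u is n :: v then
    if grow x i v is Some j then onth (x (v, j)) n else None
  else Some i.

End trees.

Section bgw.
Variables (R : realType) (K : nat).

(* xi (u, j) : the random children list used at vertex u if u has type j.
   These variables are independent and xi (u, j) has law zeta j; the
   zeta-BGW tree with root type i is then omega |-> grow (xi ^~ omega) i.
   The variables take countably many values, so that measurability and
   independence are stated on singletons. *)
Definition offspring_family (zeta : 'I_K -> seq 'I_K -> R)
    (d : measure_display) (Omega : measurableType d) (P : probability Omega R)
    (xi : seq nat * 'I_K -> Omega -> seq 'I_K) : Prop :=
  [/\ forall a w, measurable (xi a @^-1` [set w]),
      forall u j w, P (xi (u, j) @^-1` [set w]) = (zeta j w)%:E &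
      forall (s : seq (seq nat * 'I_K)) (w : seq nat * 'I_K -> seq 'I_K),
        uniq s ->
        P [set o | forall a, a \in s -> xi a o = w a] =
        (\prod_(a <- s) P (xi a @^-1` [set w a]))%E].

Definition bgw (Omega : Type) (xi : seq nat * 'I_K -> Omega -> seq 'I_K)
  (i : 'I_K) : Omega -> ptree K := fun o => grow (xi ^~ o) i.

Variables (L : nat) (Gamma : 'M[R]_(L, K)).

Definition cond_set (g : 'cV[R]_L) : set (ptree K) :=
  [set t | finite_set (vertices t) /\
           Gamma *m (\col_j (ntype t j)%:R) = g].

(* P(T in A | T in cond_set g).  There are countably many finite trees, hence
   every A is allowed. *)
Definition cond_law (d : measure_display) (Omega : measurableType d)
    (P : probability Omega R) (T : Omega -> ptree K) (g : 'cV[R]_L)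
    (A : set (ptree K)) : R :=
  fine (P (T @^-1` (cond_set g `&` A))) / fine (P (T @^-1` cond_set g)).

(* A law of BGW trees does not depend on the underlying offspring family;
   (ii) is stated for all of them. *)
Definition gamma_equivalent (zeta zeta' : 'I_K -> seq 'I_K -> R) : Prop :=
  (forall w i, zeta i w = 0 <-> zeta' i w = 0) /\
  (forall (i : 'I_K) (g : 'cV[R]_L)
     (d d' : measure_display)
     (Omega : measurableType d) (Omega' : measurableType d')
     (P : probability Omega R) (P' : probability Omega' R)
     (xi : seq nat * 'I_K -> Omega -> seq 'I_K)
     (xi' : seq nat * 'I_K -> Omega' -> seq 'I_K),
     offspring_family zeta P xi -> offspring_family zeta' P' xi' ->
     (0 < P (bgw xi i @^-1` cond_set g))%E ->
     forall A : set (ptree K),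
       cond_law P (bgw xi i) g A = cond_law P' (bgw xi' i) g A).

Definition ker_orthogonal (v : 'cV[R]_K) : Prop :=
  forall x : 'cV[R]_K, Gamma *m x = 0 -> \sum_j v j 0 * x j 0 = 0.

End bgw.

(* Main.v *)
(* Tilting: for b > 0 the family zeta' i w = zeta i w * b^w / phi_i(b), where b^w
   is the product of the b's of the letters of w, multiplies the weight of a
   finite tree with root i by the product over j of (b_j / phi_j(b))^(N_j), up to
   the factor 1 / b_i.  If b_j = c^(gamma_j) phi_j(b) for all j, this only depends
   on i and on gamma.N, hence on i and Gamma N.

   Existence: take the largest c for which the system c^(gamma_j) phi_j(b) <= b_j
   has a solution (A.3 keeps the solutions bounded) and the least solution b for
   this c, which is a fixed point.  The mean matrix M of the tilted family is the
   logarithmic derivative of b |-> phi(b).  Minimality of b forbids v >= 0, v <> 0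
   with M v >= s v, s > 1; maximality of c forbids v > 0 with M v < v.  So the
   spectral radius of M is 1.

   Uniqueness: equality of the conditional laws says that the ratio of the two
   weights of a tree only depends on its root and on gamma.N.  Comparing two ways
   of growing one tree with many leaves forces the second family to be a tilt of
   the first one with b_j = c^(gamma_j) phi_j(b).  Between two critical tilts,
   Gibbs' inequality applied in both directions and paired with the left
   Perron-Frobenius eigenvectors gives c = 1, then the equality case gives b = 1. *)

Require Import Defs.
From HB Require Import structures.
From mathcomp Require Import all_boot all_order all_algebra finmap.
From mathcomp Require Import all_classical all_reals all_analysis.
From mathcomp Require Import complex spectral lra ring.

Set Implicit Arguments.
Unset Strict Implicit.
Unset Printing Implicit Defensive.

Import Order.TTheory GRing.Theory Num.Theory.
Import numFieldNormedType.Exports.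

Local Open Scope classical_set_scope.
Local Open Scope ring_scope.

(** * Absolutely summable real families *)

(** Existence has no irreducibility to rely on, hence no Perron eigenvector: the spectral radius, a
    supremum of moduli of complex eigenvalues, is reached only through vector inequalities. The
    moduli of the coordinates of an eigenvector provide the vector that minimality forbids; an
    adjugate column provides the one that maximality forbids. They act by replacing [b] with
    [b (1 - e v)] or [b (1 + e v)]; as all coefficients are nonnegative, the second-order error is
    controlled by the value of the series at [1 + v].

    Equivalence quantifies over offspring families, so uniqueness has nothing to start from until
    one is built. Rank one supplies the converse of orthogonality: equal gamma.N forces equal Gamma
    N. Filling a leaf of type j by a word w multiplies the ratio of the two weights by a factor
    depending only on j and w; powers of these factors appear because fillings by w and w' must be
    repeated to reach the same gamma.N. A.3 supplies words j...j of length at least 2, which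
    multiply the leaves of type j, and irreducibility produces leaves of every type. *)

Lemma esumZl {R : realType} {T : choiceType} (D : set T) c (f : T -> R) :
  0 <= c -> (forall x, 0 <= f x) ->
  (\esum_(x in D) (c * f x)%:E = c%:E * \esum_(x in D) (f x)%:E)%E.
Proof.
move=> c0 f0; under eq_esum do rewrite EFinM.
rewrite /esum -ereal_supZl//; last first.
  apply/set0P; exists 0%E, set0; [exact: fsets_set0|exact: fsbig_set0].
congr ereal_sup; apply/seteqP; split => y /=.
  move=> [X fX <-]; exists (\sum_(x \in X) (f x)%:E)%E; first by exists X.
  by rewrite ge0_mule_fsumr// => x; rewrite lee_fin.
move=> [_ [X fX <-] <-]; exists X => //.
by rewrite ge0_mule_fsumr// => x; rewrite lee_fin.
Qed.

Section real_sums.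
Context {R : realType} {T : choiceType}.
Implicit Types f g : T -> R.

Definition rsummable f : Prop := (\esum_(x in [set: T]) `|f x|%:E < +oo)%E.

Let nnegE f : (forall x, 0 <= f x) ->
  (0 <= \esum_(x in [set: T]) (f x)%:E)%E.
Proof. by move=> f0; apply: esum_ge0 => x _; rewrite lee_fin. Qed.

Lemma rsummable_le f g :
  (forall x, `|f x| <= g x) -> (\esum_(x in [set: T]) (g x)%:E < +oo)%E ->
  rsummable f.
Proof. by move=> fg; apply: le_lt_trans; apply: le_esum => x _; rewrite lee_fin. Qed.

Lemma rsummable_nneg f : (forall x, 0 <= f x) ->
  (\esum_(x in [set: T]) (f x)%:E < +oo)%E -> rsummable f.
Proof. by move=> f0; apply: rsummable_le => x; rewrite ger0_norm. Qed.

Lemma rsummable_dom f g : (forall x, `|f x| <= g x) -> rsummable g -> rsummable f.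
Proof.
move=> fg; apply: le_lt_trans; apply: le_esum => x _; rewrite lee_fin.
by rewrite (le_trans (fg x))// ler_norm.
Qed.

Lemma esum_rsum f : (forall x, 0 <= f x) -> rsummable f ->
  (\esum_(x in [set: T]) (f x)%:E = (rsum f)%:E)%E.
Proof.
move=> f0 sf; rewrite /rsum [X in _ - fine X]esum1 ?subr0; last first.
  by move=> x _; rewrite max_r// oppr_le0.
have -> : \esum_(x in [set: T]) (Num.max (f x) 0)%:E = \esum_(x in [set: T]) (f x)%:E.
  by apply: eq_esum => x _; rewrite max_l.
rewrite fineK// ge0_fin_numE ?nnegE//; apply: le_lt_trans sf.
by apply: le_esum => x _; rewrite lee_fin ler_norm.
Qed.

Lemma rsum_nneg f : (forall x, 0 <= f x) ->
  rsum f = fine (\esum_(x in [set: T]) (f x)%:E).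
Proof.
move=> f0; rewrite /rsum [X in _ - fine X]esum1 ?subr0; last first.
  by move=> x _; rewrite max_r// oppr_le0.
by congr fine; apply: eq_esum => x _; rewrite max_l.
Qed.

Lemma eq_rsum f g : f =1 g -> rsum f = rsum g.
Proof. by move=> /funext ->. Qed.

Lemma rsummableD f g : rsummable f -> rsummable g -> rsummable (fun x => f x + g x).
Proof.
move=> sf sg; apply: (@rsummable_le _ (fun x => `|f x| + `|g x|)) => [x|].
  exact: ler_normD.
under eq_esum do rewrite EFinD.
by rewrite esumD ?lte_add_pinfty// => x _; rewrite lee_fin.
Qed.

Lemma rsummableN f : rsummable f -> rsummable (fun x => - f x).
Proof. by rewrite /rsummable; under eq_esum do rewrite -normrN. Qed.

Lemma rsummableB f g : rsummable f -> rsummable g -> rsummable (fun x => f x - g x).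
Proof. by move=> sf /rsummableN; exact: rsummableD. Qed.

Let rsummable_max f : rsummable f -> rsummable (fun x => Num.max (f x) 0).
Proof.
move=> sf; apply: rsummable_dom (_ : rsummable (fun x => `|f x|)) => [x|].
  by case: (leP (f x) 0) => h; rewrite ?normr0 ?lexx.
by apply: le_lt_trans sf; apply: le_esum => x _; rewrite normr_id.
Qed.

Let rsumD_nneg f g : (forall x, 0 <= f x) -> (forall x, 0 <= g x) ->
  rsummable f -> rsummable g -> rsum (fun x => f x + g x) = rsum f + rsum g.
Proof.
move=> f0 g0 sf sg; apply: EFin_inj; rewrite (EFinD (rsum f)) -!esum_rsum//.
- by rewrite -esumD// => x _; rewrite lee_fin.
- by move=> x; rewrite addr_ge0.
- exact: rsummableD.
Qed.

(** [p - q] and [f - g] are two decompositions of one family into nonnegative parts, so that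
    [p + g = f + q], and additivity for nonnegative families is enough. *)
Lemma rsum_sub f g : (forall x, 0 <= f x) -> (forall x, 0 <= g x) ->
  rsummable f -> rsummable g -> rsum (fun x => f x - g x) = rsum f - rsum g.
Proof.
move=> f0 g0 sf sg; have sfg := rsummableB sf sg.
pose p x := Num.max (f x - g x) 0; pose q x := Num.max (- (f x - g x)) 0.
have p0 x : 0 <= p x by rewrite le_max lexx orbT.
have q0 x : 0 <= q x by rewrite le_max lexx orbT.
have sp : rsummable p by exact: rsummable_max.
have sq : rsummable q by apply: rsummable_max; exact: rsummableN.
have -> : rsum (fun x => f x - g x) = rsum p - rsum q.
  by rewrite [LHS]/rsum (rsum_nneg p0) (rsum_nneg q0).
have : rsum p + rsum g = rsum f + rsum q; last by lra.
rewrite -!rsumD_nneg//; apply: eq_rsum => x; rewrite /p /q.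
case: (leP (f x - g x) 0) => h; first by rewrite max_l ?oppr_ge0//; lra.
by rewrite max_r ?oppr_le0 ?(ltW h)//; lra.
Qed.

Let pos_neg f : rsummable f -> exists p q : T -> R,
  [/\ forall x, 0 <= p x, forall x, 0 <= q x, rsummable p, rsummable q
    & f = (fun x => p x - q x)].
Proof.
move=> sf; exists (fun x => Num.max (f x) 0), (fun x => Num.max (- f x) 0); split.
- by move=> x; rewrite le_max lexx orbT.
- by move=> x; rewrite le_max lexx orbT.
- exact: rsummable_max.
- by apply: rsummable_max; exact: rsummableN.
- apply/funext => x; case: (leP (f x) 0) => h.
    by rewrite max_l ?oppr_ge0//; lra.
  by rewrite max_r ?oppr_le0 ?(ltW h)//; lra.
Qed.

Lemma rsumD f g : rsummable f -> rsummable g ->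
  rsum (fun x => f x + g x) = rsum f + rsum g.
Proof.
move=> /pos_neg[p [q [p0 q0 sp sq ->]]]. move=> /pos_neg[p' [q' [p'0 q'0 sp' sq' ->]]].
have -> : (fun x => p x - q x + (p' x - q' x)) =
          (fun x => (p x + p' x) - (q x + q' x)).
  by apply/funext => x; lra.
rewrite (rsum_sub p0 q0)// (rsum_sub p'0 q'0)// rsum_sub ?rsumD_nneg//; try lra.
- by move=> x; rewrite addr_ge0.
- by move=> x; rewrite addr_ge0.
- exact: rsummableD.
- exact: rsummableD.
Qed.

Lemma rsumN f : rsummable f -> rsum (fun x => - f x) = - rsum f.
Proof.
move=> /pos_neg[p [q [p0 q0 sp sq ->]]]; rewrite (rsum_sub p0 q0)//.
have -> : (fun x => - (p x - q x)) = (fun x => q x - p x).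
  by apply/funext => x; rewrite opprB.
by rewrite (rsum_sub q0 p0)//; lra.
Qed.

Lemma rsumB f g : rsummable f -> rsummable g ->
  rsum (fun x => f x - g x) = rsum f - rsum g.
Proof. by move=> sf sg; rewrite rsumD ?rsumN//; exact: rsummableN. Qed.

Lemma rsum_ge0 f : (forall x, 0 <= f x) -> 0 <= rsum f.
Proof. by move=> f0; rewrite rsum_nneg// fine_ge0// nnegE. Qed.

Lemma ler_rsum f g : rsummable f -> rsummable g -> (forall x, f x <= g x) ->
  rsum f <= rsum g.
Proof.
move=> sf sg fg; rewrite -subr_ge0 -rsumB// rsum_ge0// => x.
by rewrite subr_ge0.
Qed.

Lemma rsum_ge_term f x : (forall x, 0 <= f x) -> rsummable f -> f x <= rsum f.
Proof.
move=> f0 sf; rewrite -lee_fin -esum_rsum//; apply: esum_ge.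
by exists [set x]; [split=> //; exact: finite_set1|rewrite fsbig_set1].
Qed.

Lemma rsum_eq0 f : (forall x, 0 <= f x) -> rsummable f -> rsum f = 0 ->
  forall x, f x = 0.
Proof.
move=> f0 sf sf0 x; apply/le_anti; rewrite f0 andbT.
by rewrite (le_trans (rsum_ge_term x f0 sf))// sf0.
Qed.

Lemma rsum0 : rsum (fun _ : T => 0 : R) = 0.
Proof. by rewrite rsum_nneg// esum1. Qed.

Lemma rsummable0 : rsummable (fun _ => 0).
Proof. by rewrite /rsummable esum1// => x _; rewrite normr0. Qed.

Lemma rsummableZ c f : rsummable f -> rsummable (fun x => c * f x).
Proof.
move=> sf; rewrite /rsummable; under eq_esum do rewrite normrM.
by rewrite esumZl// lte_mul_pinfty// lee_fin.
Qed.

Lemma rsumZ c f : rsummable f -> rsum (fun x => c * f x) = c * rsum f.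
Proof.
wlog c0 : c / 0 <= c => [wl sf|sf].
  have [/wl->//|c0] := leP 0 c.
  rewrite -[c]opprK mulNr -wl ?oppr_ge0 ?ltW//.
  rewrite -rsumN; last exact: rsummableZ.
  by apply: eq_rsum => x; rewrite mulNr.
have [p [q [p0 q0 sp sq ->]]] := pos_neg sf.
have -> : (fun x => c * (p x - q x)) = (fun x => c * p x - c * q x).
  by apply/funext => x; rewrite mulrBr.
rewrite !rsumB//; [|exact: rsummableZ..].
rewrite mulrBr.
have Z h : (forall x, 0 <= h x) -> rsummable h -> rsum (fun x => c * h x) = c * rsum h.
  move=> h0 sh; rewrite !rsum_nneg ?esumZl//; last by move=> x; rewrite mulr_ge0.
  by rewrite fineM// esum_rsum.
by rewrite !Z.
Qed.

Lemma rsummable_sum (I : Type) (r : seq I) (f : I -> T -> R) :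
  (forall i, rsummable (f i)) -> rsummable (fun x => \sum_(i <- r) f i x).
Proof.
move=> sf; elim: r => [|i r ih].
  by under eq_fun do rewrite big_nil; exact: rsummable0.
by under eq_fun do rewrite big_cons; exact: rsummableD.
Qed.

Lemma rsum_sum (I : Type) (r : seq I) (f : I -> T -> R) :
  (forall i, rsummable (f i)) ->
  rsum (fun x => \sum_(i <- r) f i x) = \sum_(i <- r) rsum (f i).
Proof.
move=> sf; elim: r => [|i r ih].
  by rewrite big_nil -[RHS]rsum0; apply: eq_rsum => x; rewrite big_nil.
rewrite big_cons -ih -rsumD//; last exact: rsummable_sum.
by apply: eq_rsum => x; rewrite big_cons.
Qed.

End real_sums.

(** * Monomials indexed by words *)

Section word_monomials.
Context {R : realType} {I : eqType}.
Implicit Types (b y : I -> R) (w : seq I).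

Definition wprod b w : R := \prod_(x <- w) b x.

Definition wsum y w : R := \sum_(x <- w) y x.

Lemma wprod_ge0 b w : (forall j, 0 <= b j) -> 0 <= wprod b w.
Proof. by move=> b0; rewrite /wprod prodr_ge0. Qed.

Lemma wprod_gt0 b w : (forall j, 0 < b j) -> 0 < wprod b w.
Proof. by move=> b0; rewrite /wprod prodr_gt0. Qed.

Lemma wsum_ge0 y w : (forall j, 0 <= y j) -> 0 <= wsum y w.
Proof. by move=> y0; rewrite /wsum sumr_ge0. Qed.

Lemma wprodM b b' w : wprod (fun j => b j * b' j) w = wprod b w * wprod b' w.
Proof. by rewrite /wprod big_split. Qed.

Lemma wprod1 w : wprod (fun=> 1) w = 1.
Proof. by rewrite /wprod big1. Qed.

Lemma wprod_le b b' w : (forall j, 0 <= b j) -> (forall j, b j <= b' j) ->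
  wprod b w <= wprod b' w.
Proof. by move=> b0 bb'; apply: ler_prod => j _; rewrite b0 bb'. Qed.

(** What remains on the left are the terms of degree at least 2 in [e]; their coefficients are
    nonnegative, so for [|e| <= 1] they amount to at most [e ^+ 2] times their value at [e = 1]. *)
Lemma wprod_perturb y w (e : R) : (forall j, 0 <= y j) -> `|e| <= 1 ->
  `|wprod (fun j => 1 + e * y j) w - 1 - e * wsum y w| <=
  e ^+ 2 * (wprod (fun j => 1 + y j) w - 1 - wsum y w).
Proof.
move=> y0 e1; rewrite /wprod /wsum; elim: w => [|x w ih].
  by rewrite !big_nil subrr mulr0 !subr0 normr0 mulr0.
rewrite !big_cons.
set p := \prod_(_ <- _) _ in ih *; set q := \prod_(_ <- _) _ in ih *.
set s := \sum_(_ <- _) _ in ih *.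
have s0 : 0 <= s by rewrite sumr_ge0.
have -> : (1 + e * y x) * p - 1 - e * (y x + s) =
    (1 + e * y x) * (p - 1 - e * s) + e ^+ 2 * (y x * s) by ring.
have -> : e ^+ 2 * ((1 + y x) * q - 1 - (y x + s)) =
    (1 + y x) * (e ^+ 2 * (q - 1 - s)) + e ^+ 2 * (y x * s) by ring.
apply: le_trans (ler_normD _ _) _.
have es0 : 0 <= e ^+ 2 * (y x * s) by rewrite mulr_ge0 ?sqr_ge0 ?mulr_ge0.
rewrite (ger0_norm es0) lerD2r normrM ler_pM//; apply: le_trans (ler_normD _ _) _.
by rewrite normr1 lerD2l normrM (ger0_norm (y0 x)) ler_piMl.
Qed.

(** Bernoulli's inequality, with factors that may differ. *)
Lemma wprod_ge1D y w (e : R) : (forall j, 0 <= y j) -> 0 <= e ->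
  1 + e * wsum y w <= wprod (fun j => 1 + e * y j) w.
Proof.
move=> y0 e0; rewrite /wprod /wsum; elim: w => [|x w ih].
  by rewrite !big_nil mulr0 addr0.
rewrite !big_cons; set p := \prod_(_ <- _) _ in ih *; set s := \sum_(_ <- _) _ in ih *.
have s0 : 0 <= s by rewrite sumr_ge0.
have ey0 : 0 <= e * y x by rewrite mulr_ge0.
apply: le_trans (_ : (1 + e * y x) * (1 + e * s) <= _); last first.
  by rewrite ler_wpM2l// addr_ge0.
have : 0 <= e * y x * (e * s) by rewrite !mulr_ge0.
lra.
Qed.

End word_monomials.

Lemma wsum_fin {R : realType} {K : nat} (y : 'I_K -> R) w :
  wsum y w = \sum_j (count_mem j w)%:R * y j.
Proof.
rewrite /wsum; elim: w => [|x w ih].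
  by rewrite big_nil big1// => j _; rewrite mul0r.
rewrite big_cons ih/=; under [RHS]eq_bigr do rewrite natrD mulrDl.
rewrite big_split/=; congr (_ + _); rewrite (bigD1 x)//= eqxx mul1r big1 ?addr0//.
by move=> j; rewrite eq_sym => /negbTE ->; rewrite mul0r.
Qed.

Lemma wprod_fin {R : realType} {K : nat} (b : 'I_K -> R) w :
  wprod b w = \prod_j b j ^+ word_proj w j.
Proof.
rewrite /wprod; elim: w => [|x w ih].
  by rewrite big_nil big1// => j _; rewrite ffunE.
rewrite big_cons ih; under [RHS]eq_bigr do rewrite ffunE/= exprD.
rewrite big_split/=; congr (_ * _).
  rewrite (bigD1 x)//= eqxx expr1 big1 ?mulr1//.
  by move=> j; rewrite eq_sym => /negbTE ->.
by apply: eq_bigr => j _; rewrite ffunE.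
Qed.

Section weighted_words.
Context {R : realType} {I : choiceType}.
Implicit Types (a : seq I -> R) (y : I -> R).

Lemma rsummable_wprod_perturb a y (e : R) :
  (forall w, 0 <= a w) -> (forall j, 0 <= y j) -> `|e| <= 1 ->
  rsummable (fun w => a w * wprod (fun j => 1 + y j) w) ->
  rsummable (fun w => a w * wprod (fun j => 1 + e * y j) w).
Proof.
move=> a0 y0 e1; apply: rsummable_dom => w; rewrite normrM (ger0_norm (a0 w)).
rewrite ler_wpM2l// /wprod normr_prod ler_prod// => j _; rewrite normr_ge0/=.
apply: le_trans (ler_normD _ _) _; rewrite normr1 lerD2l normrM.
by rewrite (ger0_norm (y0 j)) ler_piMl.
Qed.

Lemma rsummable_wsum a y : (forall w, 0 <= a w) -> (forall j, 0 <= y j) ->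
  rsummable (fun w => a w * wprod (fun j => 1 + y j) w) ->
  rsummable (fun w => a w * wsum y w).
Proof.
move=> a0 y0; apply: rsummable_dom => w.
rewrite ger0_norm ?mulr_ge0// ?wsum_ge0// ler_wpM2l//.
have := @wprod_ge1D _ _ y w 1 y0 ler01; rewrite mul1r.
by under eq_fun do rewrite mul1r; lra.
Qed.

(** This explicit quadratic remainder takes the place of termwise differentiation: it yields the
    partial derivatives, continuity along rays and the perturbation of fixed points. *)
Lemma rsum_perturb a y (e : R) :
  (forall w, 0 <= a w) -> (forall j, 0 <= y j) -> `|e| <= 1 ->
  rsummable (fun w => a w * wprod (fun j => 1 + y j) w) ->
  `|rsum (fun w => a w * wprod (fun j => 1 + e * y j) w) - rsum a
    - e * rsum (fun w => a w * wsum y w)| <=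
  e ^+ 2 * rsum (fun w => a w * wprod (fun j => 1 + y j) w).
Proof.
move=> a0 y0 e1 sq.
have sp := rsummable_wprod_perturb a0 y0 e1 sq.
have ss := rsummable_wsum a0 y0 sq.
have sa : rsummable a.
  apply: rsummable_dom sq => w; rewrite ger0_norm//.
  rewrite ler_peMr//; have := @wprod_ge1D _ _ y w 1 y0 ler01.
  by under [X in wprod X]eq_fun do rewrite mul1r; have := wsum_ge0 w y0; lra.
have ses := rsummableZ e ss; have spa := rsummableB sp sa.
rewrite -(rsumZ _ ss) -(rsumZ _ sq) -(rsumB sp sa) -(rsumB spa ses) ler_norml.
have seq := rsummableZ (e ^+ 2) sq.
have H w : `|a w * wprod (fun j => 1 + e * y j) w - a w - e * (a w * wsum y w)|
    <= e ^+ 2 * (a w * wprod (fun j => 1 + y j) w).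
  have -> : a w * wprod (fun j => 1 + e * y j) w - a w - e * (a w * wsum y w) =
    a w * (wprod (fun j => 1 + e * y j) w - 1 - e * wsum y w) by ring.
  rewrite normrM (ger0_norm (a0 w)) mulrCA ler_wpM2l//.
  apply: le_trans (wprod_perturb w y0 e1) _; rewrite ler_wpM2l ?sqr_ge0//.
  by have := wsum_ge0 w y0; lra.
rewrite -(rsumN seq) !ler_rsum//.
- exact: rsummableB.
- by move=> w; have := H w; rewrite ler_norml => /andP[].
- exact: rsummableN.
- exact: rsummableB.
- by move=> w; have := H w; rewrite ler_norml => /andP[].
Qed.

End weighted_words.

(** * Nonnegative matrices *)

Section nonneg_matrices.
Context {R : realType} {K : nat}.
Implicit Types (M N : 'M[R]_K) (s : R).

Definition mx_nneg M := forall i j, 0 <= M i j.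

Local Notation toC := (real_complex R).

Lemma normc_ge0 (x : R[i]) : 0 <= Normc.normc x.
Proof. by case: x => a b; rewrite /Normc.normc sqrtr_ge0. Qed.

Lemma normc_real (x : R) : Normc.normc (toC x) = `|x|.
Proof. by rewrite /Normc.normc/= expr0n/= addr0 sqrtr_sqr. Qed.

Lemma normc_sum (I : Type) (r : seq I) (P : pred I) (F : I -> R[i]) :
  Normc.normc (\sum_(i <- r | P i) F i) <= \sum_(i <- r | P i) Normc.normc (F i).
Proof.
elim/big_ind2 : _ => [|x x' y y' xx' yy'|//]; first by rewrite Normc.normc0.
by rewrite (le_trans (le_normcD _ _))// lerD.
Qed.

Lemma normc_gt0 (x : R[i]) : x != 0 -> 0 < Normc.normc x.
Proof.
move=> x0; rewrite lt_def normc_ge0 andbT; apply: contra x0 => /eqP.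
by move=> /Normc.eq0_normc ->.
Qed.

(** [u] consists of the moduli of the coordinates of a complex left eigenvector; the inequality is
    the triangle inequality. *)
Lemma eigenvalue_row M (l : R[i]) : mx_nneg M ->
  eigenvalue (map_mx toC M) l -> exists2 u : 'rV[R]_K,
    (forall j, 0 <= u 0 j) /\ (exists j, 0 < u 0 j) &
    forall j, Normc.normc l * u 0 j <= (u *m M) 0 j.
Proof.
move=> M0 /eigenvalueP[v vM v0].
exists (\row_j Normc.normc (v 0 j)); first split.
- by move=> j; rewrite mxE normc_ge0.
- by have /rV0Pn[j vj] := v0; exists j; rewrite mxE normc_gt0.
- move=> j; rewrite mxE -Normc.normcM.
  have -> : l * v 0 j = (v *m map_mx toC M) 0 j by rewrite vM mxE.
  rewrite mxE (le_trans (normc_sum _ _ _))// mxE ler_sum// => i _.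
  by rewrite !mxE Normc.normcM normc_real ger0_norm.
Qed.

Lemma eigenvalue_col M (l : R[i]) : mx_nneg M ->
  eigenvalue (map_mx toC M) l -> exists2 v : 'cV[R]_K,
    (forall j, 0 <= v j 0) /\ (exists j, 0 < v j 0) &
    forall j, Normc.normc l * v j 0 <= (M *m v) j 0.
Proof.
move=> M0 eM; have : eigenvalue (map_mx toC M^T) l.
  move: eM; rewrite !eigenvalue_root_char -map_trmx /char_poly.
  rewrite -[X in _ -> is_true (root X _)]det_tr; congr (is_true (root (\det _) l)).
  by apply/matrixP => i j; rewrite !mxE eq_sym.
move=> /eigenvalue_row[|u [u0 [j uj]] uM]; first by move=> i j; rewrite mxE.
exists u^T; first split; first by move=> i; rewrite mxE.
  by exists j; rewrite mxE.
by move=> i; rewrite mxE (le_trans (uM i))// -[M in leRHS]trmxK -trmx_mul [leRHS]mxE.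
Qed.

(** Collatz-Wielandt bound: pairing [v] with the row of moduli [u] gives
    [|l| (u v) <= u M v <= s (u v)], and [u v > 0]. *)
Lemma eigenvalue_le M (v : 'cV[R]_K) s (l : R[i]) : mx_nneg M ->
  (forall i, 0 < v i 0) -> (forall i, (M *m v) i 0 <= s * v i 0) ->
  eigenvalue (map_mx toC M) l -> Normc.normc l <= s.
Proof.
move=> M0 v0 Mv /(eigenvalue_row M0)[u [u0 [j uj]] uM].
have uv0 : 0 < (u *m v) 0 0.
  rewrite mxE (bigD1 j)//= ltr_pwDl ?mulr_gt0//.
  by rewrite sumr_ge0// => i _; rewrite mulr_ge0// ltW.
rewrite -(ler_pM2r uv0); apply: (@le_trans _ _ ((u *m M *m v) 0 0)).
  rewrite !mxE mulr_sumr ler_sum// => i _; rewrite mulrA.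
  by rewrite ler_wpM2r// ltW.
rewrite -mulmxA !mxE mulr_sumr ler_sum// => i _.
by rewrite mulrCA ler_wpM2l.
Qed.

Lemma eigenvalue_has_ubound M : mx_nneg M ->
  has_ubound [set Normc.normc l | l in [set l | eigenvalue (map_mx toC M) l]].
Proof.
move=> M0; exists (\sum_i \sum_j M i j) => _ [l /= + <-].
apply: (@eigenvalue_le _ (const_mx 1)) => //; first by move=> i; rewrite mxE.
move=> i; rewrite !mxE mulr1 [leRHS](bigD1 i)//=.
under eq_bigr do rewrite mxE mulr1.
by rewrite lerDl sumr_ge0// => k _; rewrite sumr_ge0.
Qed.

Lemma normc_le_spectral_radius M (l : R[i]) : mx_nneg M ->
  eigenvalue (map_mx toC M) l -> Normc.normc l <= spectral_radius M.
Proof.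
by move=> M0 eM; apply: ub_le_sup; [exact: eigenvalue_has_ubound|exists l].
Qed.

Lemma spectral_radius_ge M (l : R) : mx_nneg M -> eigenvalue M l ->
  l <= spectral_radius M.
Proof.
move=> M0 eM; apply: le_trans (_ : `|l| <= _); first exact: ler_norm.
rewrite -normc_real normc_le_spectral_radius//.
by rewrite (eigenvalue_map toC).
Qed.

Lemma spectral_radius_le M s : (0 < K)%N -> mx_nneg M ->
  (forall l, eigenvalue (map_mx toC M) l -> Normc.normc l <= s) ->
  spectral_radius M <= s.
Proof.
move=> K0 M0 eM; apply: ge_sup => [|_ [l /= /eM ? <-//]].
have [l lM] := eigenvalue_closed (map_mx toC M) K0.
by exists (Normc.normc l), l.
Qed.

Lemma continuous_minr_seq (I : Type) (r : seq I) (x0 : R -> R) (f : I -> R -> R) :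
  continuous x0 -> (forall i, continuous (f i)) ->
  continuous (fun t => \big[Num.min/x0 t]_(i <- r) f i t).
Proof.
move=> cx0 cf; elim: r => [|i r ih].
  by under [X in continuous X]eq_fun do rewrite big_nil.
under [X in continuous X]eq_fun do rewrite big_cons.
by move=> t; apply: (@continuous_min _ _ (f i)) => //; [exact: cf|exact: ih].
Qed.

(* The adjugate column w(t) of s - t M satisfies
   s w(t) = det(s - t M) + t M w(t).  It is positive at t = 0 and, as the
   determinant does not vanish, cannot touch the boundary of the orthant. *)
Lemma exists_strict_subinvariant M s : mx_nneg M -> 0 < s ->
  (forall l, s <= l -> ~~ eigenvalue M l) ->
  exists2 v : 'cV[R]_K, (forall i, 0 < v i 0) &
    forall i, (M *m v) i 0 < s * v i 0.
Proof.
move=> M0 s0 eM.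
have [K0|K0] := posnP K.
  by exists 0 => -[i iK]; exfalso; move: iK; rewrite K0.
pose P : 'M[{poly R}]_K := s%:P%:M - 'X *: map_mx polyC M.
pose w : 'cV[{poly R}]_K := \adj P *m const_mx 1.
pose d t := \det (s%:M - t *: M).
have PE t : map_mx (horner_eval t) P = s%:M - t *: M.
  by apply/matrixP => i j; rewrite !mxE /horner_eval !hornerE hornerMn hornerC.
have dE t : d t = (\det P).[t].
  by rewrite /d -PE det_map_mx.
have wE t i : s * (w i 0).[t] = d t + t * (M *m map_mx (horner_eval t) w) i 0.
  have : (s%:M - t *: M) *m map_mx (horner_eval t) w = d t *: const_mx 1.
    by rewrite -PE -map_mxM mulmxA mul_mx_adj mul_scalar_mx map_mxZ dE map_const_mx
      rmorph1.
  rewrite mulmxBl mul_scalar_mx -scalemxAl => /matrixP/(_ i 0).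
  by rewrite !mxE mulr1 => /eqP; rewrite subr_eq => /eqP.
(* A zero at [t > 0] would make [s / t], which is at least [s], an eigenvalue of [M]. *)
have d_neq0 t : 0 <= t <= 1 -> d t != 0.
  move=> /andP[t0 t1]; apply/negP => /det0P[v v0 /eqP].
  rewrite mulmxBr subr_eq0 mul_mx_scalar -scalemxAr => /eqP vM.
  have tn0 : t != 0.
    apply/eqP => tE; move: vM; rewrite tE scale0r => /eqP.
    by rewrite scaler_eq0 (negbTE v0) orbF gt_eqF.
  have t_gt0 : 0 < t by rewrite lt_def tn0.
  have /eM/negP : s <= s / t by rewrite ler_pdivlMr// ler_piMr// ltW.
  apply; apply/eigenvalueP; exists v => //.
  by rewrite mulrC -scalerA vM scalerA mulVf// scale1r.
have d_gt0 t : 0 <= t <= 1 -> 0 < d t.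
  move=> t01; rewrite ltNge; apply/negP => dt.
  have d0 : 0 < d 0 by rewrite /d scale0r subr0 det_scalar exprn_gt0.
  have [|||x + x0] := @IVT R d 0 t 0.
  - by case/andP: t01.
  - apply: continuous_subspaceT.
    by rewrite (_ : d = horner (\det P)); [exact: continuous_horner|exact/funext].
  - by rewrite ge_min dt orbT le_max (ltW d0).
  - rewrite in_itv/= => /andP[x0' xt]; have /eqP[]// : d x != 0.
    by rewrite d_neq0// x0' (le_trans xt)//; case/andP: t01.
pose m t := \big[Num.min/(w (Ordinal K0) 0).[t]]_(i : 'I_K) (w i 0).[t].
have mle t i : m t <= (w i 0).[t] by exact: bigmin_le_cond.
have m_gt0 t : (forall i, 0 < (w i 0).[t]) -> 0 < m t.
  by move=> wt; apply: lt_bigmin => //; exact: wt.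
have m1 : 0 < m 1.
  rewrite ltNge; apply/negP => m1.
  have m0 : 0 < m 0.
    apply: m_gt0 => i; rewrite -(pmulr_rgt0 _ s0) wE mul0r addr0 d_gt0//.
    by rewrite lexx ler01.
  have [|||x + x0] := @IVT R m 0 1 0.
  - exact: ler01.
  - apply: continuous_subspaceT; apply: continuous_minr_seq; first exact: continuous_horner.
    by move=> i; exact: continuous_horner.
  - by rewrite ge_min m1 orbT le_max (ltW m0).
  - rewrite in_itv/= => x01.
    suff : 0 < m x by rewrite x0 ltxx.
    apply: m_gt0 => i; rewrite -(pmulr_rgt0 _ s0) wE ltr_pwDl ?d_gt0//.
    case/andP: x01 => x_ge0 _; rewrite mulr_ge0// mxE sumr_ge0// => j _.
    by rewrite mulr_ge0// mxE -x0 mle.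
exists (map_mx (horner_eval 1) w) => i.
  by rewrite mxE (lt_le_trans m1)// mle.
by rewrite [X in _ < s * X]mxE wE mul1r ltrDr d_gt0// lexx ler01.
Qed.

Lemma spectral_radius_lt M s : mx_nneg M -> 0 < s -> spectral_radius M < s ->
  exists2 v : 'cV[R]_K, (forall i, 0 < v i 0) &
    forall i, (M *m v) i 0 < s * v i 0.
Proof.
move=> M0 s0 rM; apply: exists_strict_subinvariant => // l sl.
apply/negP => /(spectral_radius_ge M0); rewrite leNgt => /negP; apply.
exact: lt_le_trans sl.
Qed.

Definition mx_irreducible M := forall i j, exists2 p : nat, (0 < p)%N & 0 < (M ^+ p) i j.

Lemma mx_nneg_exp M p : mx_nneg M -> mx_nneg (M ^+ p).
Proof.
move=> M0; elim: p => [|p ih] i j; first by rewrite expr0 mxE ler0n.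
by rewrite exprS mxE sumr_ge0// => k _; rewrite mulr_ge0.
Qed.

Lemma mulmx_nneg_gt0 M N i j : mx_nneg M -> mx_nneg N ->
  0 < (M *m N) i j <-> exists k, 0 < M i k /\ 0 < N k j.
Proof.
move=> M0 N0; split=> [|[k [Mk Nk]]]; last first.
  rewrite mxE (bigD1 k)//= ltr_pwDl ?mulr_gt0//.
  by rewrite sumr_ge0// => k' _; rewrite mulr_ge0.
move=> MN; apply: contrapT => nk; move: MN; rewrite ltNge => /negP; apply.
rewrite mxE big1// => k _; apply/eqP; rewrite mulf_eq0.
have := N0 k j; rewrite le_eqVlt => /orP[/eqP <-|Nk]; first by rewrite eqxx orbT.
have := M0 i k; rewrite le_eqVlt => /orP[/eqP <-|Mk]; first by rewrite eqxx.
by exfalso; apply: nk; exists k.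
Qed.

Lemma mx_irreducible_mono M N : mx_nneg M -> mx_nneg N ->
  (forall i j, 0 < M i j -> 0 < N i j) -> mx_irreducible M -> mx_irreducible N.
Proof.
move=> M0 N0 MN iM i j; have [p p0 Mp] := iM i j; exists p => //.
move: Mp {iM p0}; elim: p i j => [|p ih] i j; first by rewrite !expr0.
rewrite !exprS => /(mulmx_nneg_gt0 _ _ M0 (mx_nneg_exp p M0))[k [/MN Nik /ih Nkj]].
by apply/(mulmx_nneg_gt0 _ _ N0 (mx_nneg_exp p N0)); exists k.
Qed.

(** The radius is a supremum of moduli, possibly of non-real eigenvalues. If no real eigenvalue were
    at least 1, a positive [v] with [M v < v] would exist, and the largest of the finitely many
    quotients [(M v)_i / v_i], smaller than 1, would bound all moduli. *)
Lemma exists_eigenvalue_ge1 M : (0 < K)%N -> mx_nneg M ->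
  spectral_radius M = 1 -> exists2 l, 1 <= l & eigenvalue M l.
Proof.
move=> K0 M0 rM; apply: contrapT => nM.
have [||v v0 Mv] := @exists_strict_subinvariant M 1 M0; first exact: ltr01.
  by move=> l l1; apply/negP => eM; apply: nM; exists l.
pose s := \big[Num.max/0]_i ((M *m v) i 0 / v i 0).
have s1 : s < 1.
  by apply: bigmax_lt => // i _; rewrite ltr_pdivrMr.
suff : spectral_radius M <= s by rewrite rM leNgt s1.
apply: spectral_radius_le => // l; apply: (eigenvalue_le M0 v0) => i.
by rewrite -ler_pdivrMr//; apply: le_bigmax_cond.
Qed.

(** Wielandt's argument: an eigenvalue at least 1 gives a row with [u <= u M]. A nonzero difference
    would become positive everywhere after multiplication by a positive matrix commuting with [M],
    leaving room for a factor [1 + e], which is incompatible with radius 1. *)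
Lemma left_perron M : (0 < K)%N -> mx_nneg M -> mx_irreducible M ->
  spectral_radius M = 1 ->
  exists2 u : 'rV[R]_K, (forall j, 0 < u 0 j) & u *m M = u.
Proof.
move=> K0 M0 iM rM; have [l l1 eM] := exists_eigenvalue_ge1 K0 M0 rM.
have : eigenvalue (map_mx toC M) (toC l) by rewrite (eigenvalue_map toC).
move=> /(eigenvalue_row M0)[u [u0 [k uk]]]; rewrite normc_real ger0_norm; last first.
  by rewrite (le_trans _ l1).
move=> luM; have uM j : u 0 j <= (u *m M) 0 j.
  by rewrite (le_trans _ (luM j))// ler_peMl.
have [f fM] : exists f : 'I_K * 'I_K -> nat, forall ij, 0 < (M ^+ f ij) ij.1 ij.2.
  have : forall ij : 'I_K * 'I_K, exists p, 0 < (M ^+ p) ij.1 ij.2.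
    by move=> [i j]; have [p _] := iM i j; exists p.
  by move=> /choice[g Mg]; exists g.
(* One power of [M] per entry: the sum is positive even in the periodic case, where no single power
   is. *)
pose P : 'M[R]_K := \sum_ij (M ^+ f ij).
have P_gt0 i j : 0 < P i j.
  rewrite /P summxE (bigD1 (i, j))//= ltr_wpDr//.
  by rewrite sumr_ge0// => ij _; exact: mx_nneg_exp.
have mulP (x : 'rV[R]_K) : (forall j, 0 <= x 0 j) -> (exists j, 0 < x 0 j) ->
    forall j, 0 < (x *m P) 0 j.
  move=> x0 [i xi] j; rewrite mxE (bigD1 i)//= ltr_pwDl ?mulr_gt0//.
  by rewrite sumr_ge0// => i' _; rewrite mulr_ge0// ltW.
have PM : P *m M = M *m P.
  rewrite mulmx_suml mulmx_sumr; apply: eq_bigr => ij _.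
  by rewrite -[LHS]exprSr -[RHS]exprS.
suff uME : u *m M = u.
  exists u => // j; suff <- : u *m M ^+ f (k, j) = u.
    rewrite mxE (bigD1 k)//= ltr_wpDr ?mulr_gt0//.
    by rewrite sumr_ge0// => i _; rewrite mulr_ge0//; exact: mx_nneg_exp.
  elim: (f _) => [|p ih]; first by rewrite expr0 mulmx1.
  by rewrite exprS -[M * _]/(M *m _) mulmxA uME.
apply: contrapT => /eqP; rewrite -subr_eq0 => /rV0Pn[j].
set d : 'rV[R]_K := u *m M - u => dj.
have d0 i : 0 <= d 0 i by move: (uM i); rewrite -subr_ge0 /d !mxE.
have dP : forall j, 0 < (d *m P) 0 j by apply: mulP => //; exists j; rewrite lt_def dj d0.
have uP : forall j, 0 < (u *m P) 0 j by apply: mulP => //; exists k.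
pose e := \big[Num.min/1]_j ((d *m P) 0 j / (u *m P) 0 j).
have e0 : 0 < e by apply: lt_bigmin => // i _; rewrite divr_gt0.
have eP i : (1 + e) * (u *m P) 0 i <= (u *m P *m M) 0 i.
  have -> : u *m P *m M = d *m P + u *m P.
    by rewrite -mulmxA PM mulmxA -mulmxDl subrK.
  rewrite [leRHS](_ : _ = (d *m P) 0 i + (u *m P) 0 i); last by rewrite mxE.
  have : e * (u *m P) 0 i <= (d *m P) 0 i.
    by rewrite -ler_pdivlMr//; exact: bigmin_le_cond.
  lra.
(* A positive [v] with [M v < (1 + e) v], paired with [u P M >= (1 + e) u P], yields a number
   smaller than itself. *)
have [||v v0 Mv] := @spectral_radius_lt M (1 + e) M0.
- by rewrite addr_gt0.
- by rewrite rM ltrDl.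
have : (u *m P *m M *m v) 0 0 < (u *m P *m M *m v) 0 0; last by rewrite ltxx.
apply: (@lt_le_trans _ _ ((1 + e) * (u *m P *m v) 0 0)).
  rewrite -[X in X < _]/((_ *m _) 0 0) -(mulmxA (u *m P)) !mxE mulr_sumr.
  rewrite (bigD1 k)//= [ltRHS](bigD1 k)//= ltr_leD//.
    by rewrite mulrCA ltr_pM2l.
  by apply: ler_sum => i _; rewrite mulrCA ler_pM2l// ltW.
rewrite [X in _ * X]mxE [leRHS]mxE mulr_sumr ler_sum// => i _.
by rewrite mulrA ler_pM2r.
Qed.

End nonneg_matrices.

(** * Generating functions and means *)

Lemma esum_fibers {R : realType} {T T' : choiceType} (f : T -> T') (a : T -> \bar R) :
  (forall x, (0 <= a x)%E) ->
  (\esum_(x in [set: T]) a x =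
   \esum_(k in [set: T']) \esum_(x in [set x | f x = k]) a x)%E.
Proof.
move=> a0; rewrite esum_esum//; apply: (@reindex_esum R _ _ _ _ snd).
split=> // [[k x] [k' x']|x _]; last by exists (f x, x).
by rewrite !inE/= => -[_ <-] [_ <-] ->.
Qed.

Section families.
Context {R : realType} {K : nat}.
Implicit Types (zeta : 'I_K -> seq 'I_K -> R) (b y : 'I_K -> R).

Definition phi zeta i b : R := rsum (fun w => zeta i w * wprod b w).

Definition word_entire zeta := forall i b, (forall j, 0 <= b j) ->
  rsummable (fun w => zeta i w * wprod b w).

(** Grouping words by the finite fibres of [word_proj] makes generating functions and means sums
    over words, the form used from here on. *)
Lemma esum_word_proj (a : seq 'I_K -> R) (g : {ffun 'I_K -> nat} -> R) :
  (forall w, 0 <= a w) -> (forall k, 0 <= g k) ->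
  (\esum_(k in [set: {ffun 'I_K -> nat}])
    ((\sum_(w \in [set w | word_proj w = k]) a w) * g k)%:E =
  \esum_(w in [set: seq 'I_K]) (a w * g (word_proj w))%:E)%E.
Proof.
move=> a0 g0; rewrite (esum_fibers (@word_proj K)); last first.
  by move=> w; rewrite lee_fin mulr_ge0.
apply: eq_esum => k _.
have fk := @finite_word_proj_fiber K k.
rewrite esum_fset//; first last.
- by move=> w _; rewrite lee_fin mulr_ge0.
rewrite fsumEFin// mulr_fsuml; congr EFin; apply: eq_fsbigr => w.
by rewrite inE/= => ->.
Qed.

Lemma gen_funE zeta i b : (forall i w, 0 <= zeta i w) ->
  (forall j, 0 <= b j) -> gen_fun zeta i b = phi zeta i b.
Proof.
move=> z0 b0; have p0 k : 0 <= \prod_j b j ^+ (k : {ffun 'I_K -> nat}) j.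
  by rewrite prodr_ge0// => j _; rewrite exprn_ge0.
rewrite /gen_fun rsum_nneg; last first.
  by move=> k; rewrite mulr_ge0// /word_law_proj fsumr_ge0.
rewrite (esum_word_proj (a := zeta i) (g := fun k => \prod_j b j ^+ k j))//.
rewrite /phi rsum_nneg; last by move=> w; rewrite mulr_ge0// wprod_ge0.
by congr fine; apply: eq_esum => w _; rewrite wprod_fin.
Qed.

Lemma meanE zeta i j : (forall i w, 0 <= zeta i w) ->
  mean zeta i j = (\esum_(w in [set: seq 'I_K]) (zeta i w * (count_mem j w)%:R)%:E)%E.
Proof.
move=> z0; rewrite /mean.
under eq_esum do rewrite mulrC.
rewrite (esum_word_proj (a := zeta i) (g := fun k => (k j)%:R))//.
by apply: eq_esum => w _; rewrite ffunE.
Qed.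

Lemma entire_word_entire zeta : (forall i w, 0 <= zeta i w) -> entire zeta ->
  word_entire zeta.
Proof.
move=> z0 ez i b b0; apply: rsummable_nneg.
  by move=> w; rewrite mulr_ge0// wprod_ge0.
have p0 k : 0 <= \prod_j b j ^+ (k : {ffun 'I_K -> nat}) j.
  by rewrite prodr_ge0// => j _; rewrite exprn_ge0.
apply: le_lt_trans (ez i (fun j => real_complex R (b j))).
under eq_esum do rewrite wprod_fin.
rewrite -(esum_word_proj (a := zeta i) (g := fun k => \prod_j b j ^+ k j))//.
apply: le_esum => k _; rewrite lee_fin.
under [X in _ <= Normc.normc (_ * X)]eq_bigr do rewrite -rmorphXn.
by rewrite -rmorph_prod -rmorphM normc_real ler_norm.
Qed.

Lemma phi_ge0 zeta i b : (forall i w, 0 <= zeta i w) -> (forall j, 0 <= b j) ->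
  0 <= phi zeta i b.
Proof. by move=> z0 b0; apply: rsum_ge0 => w; rewrite mulr_ge0// wprod_ge0. Qed.

Lemma phi_ge_nil zeta i b : (forall i w, 0 <= zeta i w) -> word_entire zeta ->
  (forall j, 0 <= b j) -> zeta i [::] <= phi zeta i b.
Proof.
move=> z0 ez b0; have -> : zeta i [::] = zeta i [::] * wprod b [::].
  by rewrite /wprod big_nil mulr1.
apply: (@rsum_ge_term _ _ (fun w => zeta i w * wprod b w)); last exact: ez.
by move=> w; rewrite mulr_ge0// wprod_ge0.
Qed.

Lemma phi_gt0 zeta i b : (forall i w, 0 <= zeta i w) -> word_entire zeta ->
  0 < zeta i [::] -> (forall j, 0 <= b j) -> 0 < phi zeta i b.
Proof.
by move=> z0 ez zi b0; exact: lt_le_trans (phi_ge_nil _ z0 ez b0).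
Qed.

Lemma phi_le zeta i b b' : (forall i w, 0 <= zeta i w) -> word_entire zeta ->
  (forall j, 0 <= b j) -> (forall j, b j <= b' j) -> phi zeta i b <= phi zeta i b'.
Proof.
move=> z0 ez b0 bb'; apply: ler_rsum.
- exact: ez.
- by apply: ez => j; rewrite (le_trans (b0 j)).
- by move=> w; rewrite ler_wpM2l// wprod_le.
Qed.

End families.

(** * Partial derivatives and the growth condition *)

Section superlinear_words.
Context {R : realType} {K : nat}.
Variable zeta : 'I_K -> seq 'I_K -> R.
Hypothesis z0 : forall i w, 0 <= zeta i w.
Hypothesis ez : word_entire zeta.

Definition upd (b : 'I_K -> R) i t : 'I_K -> R := fun j => if j == i then t else b j.

Lemma rsummable_phi_perturb i b y : (forall j, 0 <= b j) -> (forall j, 0 <= y j) ->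
  rsummable (fun w => (zeta i w * wprod b w) * wprod (fun j => 1 + y j) w).
Proof.
move=> b0 y0; have := @ez i (fun j => b j * (1 + y j)).
under eq_fun do rewrite wprodM mulrA.
by apply=> j; rewrite mulr_ge0// addr_ge0.
Qed.

Lemma phi_mul i b c : phi zeta i (fun j => b j * c j) =
  rsum (fun w => (zeta i w * wprod b w) * wprod c w).
Proof. by apply: eq_rsum => w; rewrite wprodM mulrA. Qed.

Lemma wsum_delta i w : wsum (fun j : 'I_K => (j == i)%:R : R) w = (count_mem i w)%:R.
Proof.
rewrite wsum_fin (bigD1 i)//= eqxx mulr1 big1 ?addr0// => j /negbTE ->.
by rewrite mulr0.
Qed.

(** For [b i > 0] this is [b i] times the partial derivative of [phi zeta i] in direction [i], so
    that the growth condition loses its denominators. *)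
Definition dphi i b : R := rsum (fun w => (zeta i w * wprod b w) * (count_mem i w)%:R).

Lemma partial_derivativeE i b : (forall j, 0 <= b j) -> 0 < b i ->
  partial_derivative (gen_fun zeta i) i b = dphi i b / b i.
Proof.
move=> b0 bi; rewrite /partial_derivative; apply: cvg_lim => //.
have bn0 : b i != 0 by rewrite gt_eqF.
pose y : 'I_K -> R := fun j => (j == i)%:R.
have y0 j : 0 <= y j by rewrite ler0n.
pose C := rsum (fun w => (zeta i w * wprod b w) * wprod (fun j => 1 + y j) w).
have C0 : 0 <= C.
  apply: rsum_ge0 => w; rewrite !mulr_ge0// ?wprod_ge0// => j.
  by rewrite addr_ge0.
have FE h : `|h| <= b i -> gen_fun zeta i (fun j => if j == i then h + b i else b j)
    = rsum (fun w => (zeta i w * wprod b w) * wprod (fun j => 1 + h / b i * y j) w).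
  move=> hb; have hb' : - b i <= h by move: hb; rewrite ler_norml => /andP[].
  rewrite gen_funE//; last by move=> j; case: eqP => // _; lra.
  rewrite -phi_mul; congr phi; apply/funext => j; rewrite /y.
  case: eqP => [->|_]; last by rewrite mulr0 addr0 mulr1.
  by rewrite mulr1 mulrDr mulr1 mulrC divfK// addrC.
have gE : gen_fun zeta i (fun j => if j == i then b i else b j) =
    rsum (fun w => zeta i w * wprod b w).
  rewrite gen_funE//; last by move=> j; case: eqP.
  by congr phi; apply/funext => j; case: eqP => // ->.
apply/cvgrPdist_le => e e0; near=> h.
have hn0 : h != 0 by near: h; exact: nbhs_dnbhs_neq.
have hb : `|h| <= b i by near: h; exact: dnbhs0_le.
(* The error of the difference quotient is at most [|h| * C / b i ^+ 2]; [C + 1] keeps the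
   denominator positive when [C = 0]. *)
have he : `|h| <= e * b i ^+ 2 / (C + 1).
  by near: h; apply: dnbhs0_le; rewrite divr_gt0 ?mulr_gt0// ?exprn_gt0// ltr_pwDr.
rewrite FE// gE.
have e1 : `|h / b i| <= 1.
  by rewrite normrM normfV (gtr0_norm bi) ler_pdivrMr// mul1r.
have /= := rsum_perturb (a := fun w => zeta i w * wprod b w) _ y0 e1
  (rsummable_phi_perturb i b0 y0).
rewrite -/C; set A := rsum _; set B := rsum _; set D := rsum _.
have -> : D = dphi i b by apply: eq_rsum => w; rewrite wsum_delta.
have z0' w : 0 <= zeta i w * wprod b w by rewrite mulr_ge0// wprod_ge0.
move=> /(_ z0') H.
have -> : dphi i b / b i - h^-1 *: (A - B) = - (h^-1 * (A - B - h / b i * dphi i b)).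
  by rewrite /GRing.scale/=; field; rewrite hn0 bn0.
rewrite normrN normrM normfV ler_pdivrMl ?normr_gt0//.
apply: le_trans H _.
have -> : (h / b i) ^+ 2 * C = `|h| * (`|h| * C / b i ^+ 2).
  by rewrite expr_div_n -[h ^+ 2]real_normK ?num_real//; field.
rewrite ler_wpM2l// ler_pdivrMr ?exprn_gt0//.
apply: le_trans (_ : `|h| * (C + 1) <= _); first by rewrite ler_wpM2l// lerDl.
by rewrite -ler_pdivlMr// ltr_pwDr.
Unshelve. all: by end_near.
Qed.

Hypothesis sz : superlinear zeta.

(* [A.3] in terms of words. *)
Lemma superlinear_dphi i : exists2 B : R, 0 < B &
  forall b, (forall j, 0 <= b j) -> B <= b i -> phi zeta i b <= dphi i b.
Proof.
have [B B0 H] := sz i; exists B => // b b0 Bb.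
have bi : 0 < b i by exact: lt_le_trans Bb.
have := H b Bb (fun j _ => b0 j).
by rewrite partial_derivativeE// gen_funE// ler_pM2r ?invr_gt0.
Qed.

(** By Bernoulli's inequality on each word, multiplying [b i] by [l] adds at least
    [(l - 1) * dphi i b], which beyond [B] is at least [(l - 1) * phi zeta i b]. Thus
    [phi zeta i b / b i] does not decrease in [b i] there. *)
Lemma superlinear_phi i : exists2 B : R, 0 < B &
  forall b, (forall j, 0 <= b j) -> B <= b i ->
  forall l, 1 <= l -> l * phi zeta i b <= phi zeta i (upd b i (l * b i)).
Proof.
have [B B0 H] := superlinear_dphi i; exists B => // b b0 Bb l l1.
pose y : 'I_K -> R := fun j => (j == i)%:R.
have y0 j : 0 <= y j by rewrite ler0n.
have ub0 j : 0 <= upd b i (l * b i) j.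
  by rewrite /upd; case: ifP => // _; rewrite mulr_ge0// (le_trans _ l1).
have uE w : wprod (upd b i (l * b i)) w =
    wprod b w * wprod (fun j => 1 + (l - 1) * y j) w.
  rewrite -wprodM; congr wprod; apply/funext => j; rewrite /upd /y.
  case: eqP => [->|_]; last by rewrite mulr0 addr0 mulr1.
  by rewrite mulr1 addrC subrK mulrC.
have sd : rsummable (fun w => zeta i w * wprod b w * (count_mem i w)%:R).
  have /= := rsummable_wsum (a := fun w => zeta i w * wprod b w) _ y0
    (rsummable_phi_perturb i b0 y0).
  under eq_fun do rewrite wsum_delta.
  by apply=> w; rewrite mulr_ge0// wprod_ge0.
apply: le_trans (_ : phi zeta i b + (l - 1) * dphi i b <= _).
  have := H b b0 Bb; rewrite -subr_ge0 => h; rewrite -subr_ge0.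
  have -> : phi zeta i b + (l - 1) * dphi i b - l * phi zeta i b =
     (l - 1) * (dphi i b - phi zeta i b) by ring.
  by rewrite mulr_ge0// subr_ge0.
have sz' := ez i b0.
rewrite /phi /dphi -rsumZ// -rsumD//; last exact: rsummableZ.
apply: ler_rsum.
- by apply: rsummableD => //; exact: rsummableZ.
- exact: ez.
move=> w; rewrite uE [leRHS]mulrA.
have -> : zeta i w * wprod b w + (l - 1) * (zeta i w * wprod b w * (count_mem i w)%:R)
    = zeta i w * wprod b w * (1 + (l - 1) * (count_mem i w)%:R) by ring.
rewrite ler_wpM2l ?mulr_ge0 ?wprod_ge0//.
by rewrite -wsum_delta wprod_ge1D// subr_ge0.
Qed.

(** At the point with [B] in coordinate [i] and 0 elsewhere only words made of [i] contribute. If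
    all those of positive weight had length at most 1, [dphi] would be below [phi] term by term,
    strictly at the empty word, against the growth condition. *)
Lemma superlinear_word i : 0 < zeta i [::] ->
  exists2 n, (1 < n)%N & 0 < zeta i (nseq n i).
Proof.
move=> zi; apply: contrapT => nw.
have [B B0 H] := superlinear_dphi i.
pose b j : R := if j == i then B else 0.
have b0 j : 0 <= b j by rewrite /b; case: ifP => // _; exact: ltW.
have bi : b i = B by rewrite /b eqxx.
have := H b b0; rewrite bi lexx => /(_ isT); rewrite leNgt => /negP; apply.
pose y : 'I_K -> R := fun j => (j == i)%:R.
have y0 j : 0 <= y j by rewrite ler0n.
have z0' w : 0 <= zeta i w * wprod b w by rewrite mulr_ge0// wprod_ge0.
have sd : rsummable (fun w => zeta i w * wprod b w * (count_mem i w)%:R).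
  have /= := rsummable_wsum (a := fun w => zeta i w * wprod b w) z0' y0
    (rsummable_phi_perturb i b0 y0).
  by under eq_fun do rewrite wsum_delta.
have T w : 0 <= zeta i w * wprod b w - zeta i w * wprod b w * (count_mem i w)%:R.
  have [ai|/allPn[j jw ji]] := boolP (all (pred1 i) w); last first.
    suff -> : wprod b w = 0 by rewrite !mulr0 mul0r subrr.
    have bj : b j = 0 by rewrite /b; move: ji => /= /negbTE ->.
    by rewrite /wprod (big_rem j jw)/= bj mul0r.
  have /all_pred1P wE := ai; have [n1|n1] := leqP (size w) 1.
    rewrite subr_ge0 ler_piMr// -[leRHS]/(1%:R) ler_nat.
    exact: leq_trans (count_size _ _) n1.
  suff -> : zeta i w = 0 by rewrite !mul0r subrr.
  apply/le_anti; rewrite z0 andbT leNgt; apply/negP => zw; apply: nw.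
  by exists (size w) => //; rewrite -wE.
have sT : rsummable (fun w => zeta i w * wprod b w - zeta i w * wprod b w * (count_mem i w)%:R).
  by apply: rsummableB => //; exact: ez.
rewrite -subr_gt0 /phi /dphi -rsumB//; last exact: ez.
apply: lt_le_trans (rsum_ge_term [::] T sT).
by rewrite mulr0 subr0 /wprod big_nil mulr1.
Qed.

(** Continuity along a ray is all that passing to the supremum of the admissible [c] requires. *)
Lemma phi_scale_continuous i b : (forall j, 0 <= b j) ->
  (fun l : R => phi zeta i (fun j => b j * l)) @ (1 : R) --> phi zeta i b.
Proof.
move=> b0; pose y : 'I_K -> R := fun=> 1.
have y0 j : 0 <= y j by [].
have z0' w : 0 <= zeta i w * wprod b w by rewrite mulr_ge0// wprod_ge0.
pose D := rsum (fun w => zeta i w * wprod b w * wsum y w).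
pose Q := rsum (fun w => zeta i w * wprod b w * wprod (fun j => 1 + y j) w).
have D0 : 0 <= D by apply: rsum_ge0 => w; rewrite mulr_ge0// wsum_ge0.
have Q0 : 0 <= Q.
  by apply: rsum_ge0 => w; rewrite mulr_ge0// wprod_ge0// => j; rewrite addr_ge0.
apply/cvgrPdist_le => e e0; near=> l.
have l1 : `|1 - l| <= 1 by near: l; apply: cvgr_dist_le.
have le : `|1 - l| <= e / (D + Q + 1).
  near: l; apply: cvgr_dist_le => //.
  by rewrite divr_gt0// ltr_pwDr// addr_ge0.
have := rsum_perturb z0' y0 (e := l - 1) _ (rsummable_phi_perturb i b0 y0).
rewrite distrC => /(_ l1); rewrite -/D -/Q.
have -> : rsum (fun w => zeta i w * wprod b w * wprod (fun j => 1 + (l - 1) * y j) w)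
    = phi zeta i (fun j => b j * l).
  rewrite phi_mul; apply: eq_rsum => w; congr (_ * wprod _ _).
  by apply/funext => j; rewrite mulr1 addrC subrK.
rewrite -/(phi zeta i b) => H.
have -> : phi zeta i b - phi zeta i (fun j => b j * l) =
  - ((phi zeta i (fun j => b j * l) - phi zeta i b - (l - 1) * D) + (l - 1) * D) by ring.
rewrite normrN; apply: le_trans (ler_normD _ _) _.
rewrite normrM (ger0_norm D0) (distrC l 1).
apply: le_trans (_ : `|1 - l| * Q + `|1 - l| * D <= _).
  rewrite lerD2r (le_trans H)// ler_wpM2r// -real_normK ?num_real//.
  by rewrite (distrC l 1) expr2 ler_piMl.
rewrite -mulrDr; apply: le_trans (_ : `|1 - l| * (D + Q + 1) <= _).
  by rewrite ler_wpM2l//; lra.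
by rewrite -ler_pdivlMr// ltr_pwDr// addr_ge0.
Unshelve. all: by end_near.
Qed.

End superlinear_words.

(** * Mean matrices as sums over words *)

Section means.
Context {R : realType} {K : nat}.
Variable z : 'I_K -> seq 'I_K -> R.
Hypothesis z0 : forall i w, 0 <= z i w.

Lemma rsummable_count i j : (mean z i j < +oo)%E ->
  rsummable (fun w => z i w * (count_mem j w)%:R).
Proof.
rewrite meanE// => h; apply: rsummable_nneg => // w.
by rewrite mulr_ge0.
Qed.

Lemma mean_mxE i j : mean_mx z i j = rsum (fun w => z i w * (count_mem j w)%:R).
Proof. by rewrite mxE meanE// rsum_nneg// => w; rewrite mulr_ge0. Qed.

Lemma mean_mx_nneg : mx_nneg (mean_mx z).
Proof. by move=> i j; rewrite mean_mxE; apply: rsum_ge0 => w; rewrite mulr_ge0. Qed.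

Lemma mean_mx_gt0_word i j : 0 < mean_mx z i j -> exists2 w, 0 < z i w & j \in w.
Proof.
move=> Mij; apply: contrapT => nw; move: Mij; rewrite mean_mxE.
rewrite (_ : (fun w => _) = (fun=> 0)) ?rsum0 ?ltxx//; apply/funext => w.
have [jw|/count_memPn ->] := boolP (j \in w); last by rewrite mulr0.
have := z0 i w; rewrite le_eqVlt => /orP[/eqP <-|zw]; first by rewrite mul0r.
by exfalso; apply: nw; exists w.
Qed.

Hypothesis mz : forall i j, (mean z i j < +oo)%E.

Lemma mean_mx_gt0 i j w : 0 < z i w -> j \in w -> 0 < mean_mx z i j.
Proof.
move=> zw jw; rewrite mean_mxE.
apply: lt_le_trans (rsum_ge_term w _ (rsummable_count (mz i j))).
  by rewrite mulr_gt0// ltr0n -has_count has_pred1.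
by move=> w'; rewrite mulr_ge0.
Qed.

Lemma wsum_sum i (y : 'I_K -> R) w :
  z i w * wsum y w = \sum_j y j * (z i w * (count_mem j w)%:R).
Proof.
by rewrite wsum_fin mulr_sumr; apply: eq_bigr => j _; rewrite mulrA mulrC.
Qed.

Lemma rsummable_mean i (y : 'I_K -> R) : rsummable (fun w => z i w * wsum y w).
Proof.
under eq_fun do rewrite wsum_sum.
by apply: rsummable_sum => j; apply: rsummableZ; exact: rsummable_count.
Qed.

Lemma mean_mx_mul i (y : 'cV[R]_K) :
  (mean_mx z *m y) i 0 = rsum (fun w => z i w * wsum (y ^~ 0) w).
Proof.
rewrite mxE; under [in RHS]eq_rsum do rewrite wsum_sum.
rewrite rsum_sum; last first.
  by move=> j; apply: rsummableZ; exact: rsummable_count.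
apply: eq_bigr => j _; rewrite rsumZ; last exact: rsummable_count.
by rewrite mean_mxE mulrC.
Qed.

End means.

Lemma word_entire_mean {R : realType} {K : nat} (z : 'I_K -> seq 'I_K -> R) i j :
  (forall i w, 0 <= z i w) -> word_entire z -> (mean z i j < +oo)%E.
Proof.
move=> z0 ez; rewrite meanE//.
have s : rsummable (fun w => z i w * (count_mem j w)%:R).
  under eq_fun do rewrite -(@wsum_delta R).
  apply: rsummable_wsum => //; apply: ez => j'; rewrite addr_ge0//.
by rewrite esum_rsum ?ltry// => w; rewrite mulr_ge0.
Qed.

(** * Existence of a critical tilt *)

Section tilts.
Context {R : realType} {K : nat}.
Variable zeta : 'I_K -> seq 'I_K -> R.
Hypothesis z0 : forall i w, 0 <= zeta i w.
Hypothesis ez : word_entire zeta.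
Hypothesis znil : forall i, 0 < zeta i [::].

Definition tilt (b : 'I_K -> R) : 'I_K -> seq 'I_K -> R :=
  fun i w => zeta i w * wprod b w / phi zeta i b.

Variable b : 'I_K -> R.
Hypothesis b0 : forall j, 0 < b j.

Let b0' j : 0 <= b j. Proof. exact: ltW. Qed.

Let phib i : 0 < phi zeta i b. Proof. exact: phi_gt0. Qed.

Lemma tilt_ge0 i w : 0 <= tilt b i w.
Proof. by rewrite /tilt divr_ge0 ?mulr_ge0 ?wprod_ge0// ltW. Qed.

(** Multiplicative coordinates around [b] turn the fixed-point problem at [b] into one at the point
    1 for a family of total mass 1. *)
Lemma phi_tilt i y : (forall j, 0 <= y j) ->
  phi zeta i (fun j => b j * y j) = phi zeta i b * phi (tilt b) i y.
Proof.
move=> y0; rewrite phi_mul.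
transitivity (rsum (fun w => phi zeta i b * (tilt b i w * wprod y w))).
  by apply: eq_rsum => w; rewrite /tilt; field; rewrite gt_eqF.
rewrite rsumZ//.
have := @ez i (fun j => b j * y j).
under eq_fun do rewrite wprodM.
have H : (fun w => tilt b i w * wprod y w) =
    (fun w => (phi zeta i b)^-1 * (zeta i w * (wprod b w * wprod y w))).
  by apply/funext => w; rewrite /tilt; ring.
by rewrite H => h; apply: rsummableZ; apply: h => j; rewrite mulr_ge0.
Qed.

Lemma tilt_entire : word_entire (tilt b).
Proof.
move=> i y y0; have := @ez i (fun j => b j * y j).
under eq_fun do rewrite wprodM.
have -> : (fun w => tilt b i w * wprod y w) =
    (fun w => (phi zeta i b)^-1 * (zeta i w * (wprod b w * wprod y w))).
  by apply/funext => w; rewrite /tilt; ring.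
by move=> h; apply: rsummableZ; apply: h => j; rewrite mulr_ge0.
Qed.

Lemma phi_tilt1 i : phi (tilt b) i (fun=> 1) = 1.
Proof.
apply: (mulfI (_ : phi zeta i b != 0)); first by rewrite gt_eqF.
rewrite -phi_tilt// mulr1; congr phi; apply/funext => j; exact: mulr1.
Qed.

Lemma tilt_prob : prob_family (tilt b).
Proof.
split=> i; first exact: tilt_ge0.
have s : rsummable (tilt b i).
  by have := @tilt_entire i (fun=> 1) (fun=> ler01); under eq_fun do rewrite wprod1 mulr1.
rewrite esum_rsum//; last exact: tilt_ge0.
rewrite -(phi_tilt1 i); congr EFin; apply: eq_rsum => w.
by rewrite wprod1 mulr1.
Qed.

(** Second-order expansion at 1, where the value is 1 and the derivative is the mean matrix; it is
    applied with both signs of [e]. *)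
Lemma tilt_perturb i (y : 'cV[R]_K) e : (forall j, 0 <= y j 0) -> `|e| <= 1 ->
  phi (tilt b) i (fun j => 1 + e * y j 0) <=
  1 + e * (mean_mx (tilt b) *m y) i 0 + e ^+ 2 * phi (tilt b) i (fun j => 1 + y j 0).
Proof.
move=> y0 e1; rewrite (mean_mx_mul tilt_ge0); last first.
  by move=> i' j; apply: word_entire_mean; [exact: tilt_ge0|exact: tilt_entire].
have := rsum_perturb (a := tilt b i) (tilt_ge0 i) y0 e1.
have sq := @tilt_entire i (fun j => 1 + y j 0).
move=> /(_ (sq _)) H; have {}H := H (fun j => addr_ge0 ler01 (y0 j)).
have T1 : rsum (tilt b i) = 1.
  by rewrite -(phi_tilt1 i); apply: eq_rsum => w; rewrite wprod1 mulr1.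
move: H; rewrite T1 ler_norml => /andP[_]; rewrite -/(phi _ _ _) -/(phi _ _ _).
by rewrite lerBlDr lerBlDr; lra.
Qed.

End tilts.

Section critical_tilt.
Context {R : realType} {K : nat}.
Variable zeta : 'I_K -> seq 'I_K -> R.
Hypothesis K0 : (0 < K)%N.
Hypothesis z0 : forall i w, 0 <= zeta i w.
Hypothesis ez : word_entire zeta.
Hypothesis znil : forall i, 0 < zeta i [::].
Hypothesis sz : superlinear zeta.
Variable gamma : 'I_K -> nat.
Hypothesis gamma_gt0 : forall i, (0 < gamma i)%N.

Let F c b i : R := c ^+ gamma i * phi zeta i b.

Let supersol c b := (forall i, 0 <= b i) /\ (forall i, F c b i <= b i).

Let F_ge0 c b i : 0 <= c -> (forall j, 0 <= b j) -> 0 <= F c b i.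
Proof. by move=> c0 b0; rewrite mulr_ge0 ?exprn_ge0 ?phi_ge0. Qed.

Let F_gt0 c b i : 0 < c -> (forall j, 0 <= b j) -> 0 < F c b i.
Proof. by move=> c0 b0; rewrite mulr_gt0 ?exprn_gt0 ?phi_gt0. Qed.

Let F_le c c' b b' i : 0 <= c -> c <= c' -> (forall j, 0 <= b j) ->
  (forall j, b j <= b' j) -> F c b i <= F c' b' i.
Proof.
move=> c0 cc' b0 bb'; rewrite ler_pM ?exprn_ge0 ?phi_ge0 ?phi_le//.
by rewrite lerXn2r// nnegrE// (le_trans c0).
Qed.

Let exB : exists B : 'I_K -> R, (forall i, 0 < B i) /\
  forall i b, (forall j, 0 <= b j) -> B i <= b i ->
    forall l, 1 <= l -> l * phi zeta i b <= phi zeta i (upd b i (l * b i)).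
Proof.
have /choice[B HB] : forall i, exists B : R, 0 < B /\ 
    forall b, (forall j, 0 <= b j) -> B <= b i ->
    forall l, 1 <= l -> l * phi zeta i b <= phi zeta i (upd b i (l * b i)).
  by move=> i; have [B B0 H] := superlinear_phi z0 ez sz i; exists B.
by exists B; split => i; have [] := HB i.
Qed.

(* [A.3] allows any supersolution to be cut at B. *)
Let supersol_min B : (forall i, 0 < B i) ->
  (forall i b, (forall j, 0 <= b j) -> B i <= b i ->
    forall l, 1 <= l -> l * phi zeta i b <= phi zeta i (upd b i (l * b i))) ->
  forall c b, 0 <= c -> supersol c b -> supersol c (fun j => Num.min (b j) (B j)).
Proof.
move=> B0 HB c b c0 [b0 Fb].
have m0 j : 0 <= Num.min (b j) (B j) by rewrite le_min b0 ltW.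
split=> // i; have [bB|Bb] := leP (b i) (B i).
  by apply: le_trans (Fb i); apply: F_le => // j; rewrite ge_min lexx.
pose b' := upd b i (B i); pose l := b i / B i.
have l1 : 1 <= l by rewrite ler_pdivlMr// mul1r ltW.
have b'0 j : 0 <= b' j by rewrite /b' /upd; case: ifP => // _; rewrite ltW.
have b'i : b' i = B i by rewrite /b' /upd eqxx.
have := HB i b' b'0; rewrite b'i lexx => /(_ isT l l1).
have -> : upd b' i (l * B i) = b.
  apply/funext => j; rewrite /upd; case: eqP => [->|ji].
    by rewrite divfK// gt_eqF.
  by rewrite /b' /upd; case: eqP.
move=> H; apply: le_trans (_ : F c b' i <= _).
  apply: F_le => // j; rewrite /b' /upd; case: eqP => [->|_].
    by rewrite ge_min lexx orbT.
  by rewrite ge_min lexx.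
have l0 : 0 < l by exact: lt_le_trans l1.
rewrite -(ler_pM2l l0) [leRHS](_ : _ = b i); last by rewrite divfK// gt_eqF.
apply: le_trans (Fb i); rewrite /F mulrCA ler_wpM2l// exprn_ge0//.
Qed.

(* For fixed c the infimum m c of the supersolutions is a fixed point
   (Knaster-Tarski); m increases with c and stays below B, so that its limit at
   the supremum of the admissible c is again a supersolution. *)
Let exists_extremal : exists c b, [/\ 0 < c, forall i, 0 < b i,
   forall i, F c b i = b i,
   forall b', supersol c b' -> forall i, b i <= b' i &
   forall c' b', supersol c' b' -> c' <= c].
Proof.
have [B [B0 HB]] := exB.
pose i0 := Ordinal K0.
pose C := [set c : R | 0 <= c /\ exists b, supersol c b].
(* If [c > 1] then [c <= c ^+ gamma i0], and a supersolution cut at [B] gives [c * zeta i0 [::] <= B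
   i0]. *)
have Cub : has_ubound C.
  exists (Num.max 1 (B i0 / zeta i0 [::])) => c [c0 [b bc]].
  have [c1|c1] := leP c 1; first by rewrite le_max c1.
  have [m0 Fm] := supersol_min B0 HB c0 bc.
  rewrite le_max; apply/orP; right; rewrite ler_pdivlMr//.
  apply: (@le_trans _ _ (F c (fun j => Num.min (b j) (B j)) i0)); last first.
    by apply: le_trans (Fm i0) _; rewrite ge_min lexx orbT.
  apply: ler_pM => //.
    by rewrite -[leLHS]expr1 ler_weXn2l// ltW.
  exact: phi_ge_nil.
(* The minimum with 1 ensures [c ^+ gamma i <= c], and then [B] itself is a supersolution. *)
have [c1 c1_gt0 C1] : exists2 c, 0 < c & C c.
  have B0' j : 0 <= B j by exact: ltW.
  have pB i : 0 < phi zeta i B by exact: phi_gt0.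
  exists (\big[Num.min/1]_i (B i / phi zeta i B)).
    by apply: lt_bigmin => // i _; rewrite divr_gt0.
  set c := \big[_/_]_i _.
  have c0 : 0 <= c by apply: le_bigmin => // i _; rewrite divr_ge0// ltW.
  split=> //; exists B; split=> // i; rewrite /F -ler_pdivlMr//.
  apply: (@le_trans _ _ c); last exact: bigmin_le_cond.
  by rewrite -[leRHS]expr1 ler_wiXn2l//; exact: bigmin_le_id.
have C0 : C !=set0 by exists c1.
pose m c i := inf [set b i | b in supersol c].
have m_lb c i : has_lbound [set b i | b in supersol c].
  by exists 0 => _ [b [b0 _] <-].
have m_le c b i : supersol c b -> m c i <= b i.
  by move=> bc; apply: ge_inf => //; exists b.
have m_ge c i x : C c -> (forall b, supersol c b -> x <= b i) -> x <= m c i.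
  move=> [_ [b bc]] h; apply: lb_le_inf; first by exists (b i), b.
  by move=> _ [b' bc' <-]; exact: h.
have m_ge0 c i : C c -> 0 <= m c i by move=> Cc; apply: m_ge => // b [].
have m_super c : C c -> supersol c (m c).
  move=> Cc; split=> [i|i]; first exact: m_ge0.
  apply: m_ge => // b bc; apply: le_trans (_ : F c b i <= _); last by case: bc.
  by apply: F_le => //; [case: Cc|move=> j; exact: m_ge0|move=> j; exact: m_le].
(* [F c (m c)] is again a supersolution, hence lies above the infimum. *)
have m_fix c i : C c -> F c (m c) i = m c i.
  move=> Cc; have [mc0 Fm] := m_super _ Cc; have [c0 _] := Cc.
  apply/le_anti; rewrite Fm/=; apply: m_le; split=> j; first exact: F_ge0.
  by apply: F_le => // k; exact: F_ge0.
have m_mono c c' i : C c -> C c' -> c <= c' -> m c i <= m c' i.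
  move=> Cc Cc' cc'; apply: m_le; have [mc0 Fm] := m_super _ Cc'; split=> // j.
  by apply: le_trans (Fm j); apply: F_le => //; case: Cc.
have m_B c i : C c -> m c i <= B i.
  move=> Cc; have [c0 _] := Cc.
  apply: le_trans (m_le _ _ _ (supersol_min B0 HB c0 (m_super c Cc))) _.
  by rewrite ge_min lexx orbT.
pose cs := sup C.
have cs_gt0 : 0 < cs by apply: lt_le_trans c1_gt0 _; exact: ub_le_sup.
pose bs i := sup [set m c i | c in C].
have bs_ub i : has_ubound [set m c i | c in C].
  by exists (B i) => _ [c Cc <-]; exact: m_B.
have m_bs c i : C c -> m c i <= bs i.
  by move=> Cc; apply: ub_le_sup => //; exists c.
have bs_gt0 i : 0 < bs i.
  apply: lt_le_trans (m_bs c1 i C1); rewrite -m_fix//.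
  by apply: F_gt0 => // j; exact: m_ge0.
(* One [c] serves all coordinates: [m] increases with [c], so the largest of finitely many
   candidates will do. *)
have near_sup l : 0 < l < 1 -> exists2 c, C c &
    l * cs <= c /\ forall i, l * bs i <= m c i.
  move=> /andP[l0 l1].
  have [c0' Cc0' lc0'] : exists2 c, C c & l * cs < c.
    by apply: sup_gt => //; rewrite -/cs gtr_pMl.
  have /choice[g Hg] : forall i, exists c, C c /\ l * bs i < m c i.
    move=> i; have [||_ [c Cc <-] lc] := @sup_gt _ [set m c i | c in C] (l * bs i).
    - by exists (m c1 i), c1.
    - by rewrite -/(bs i) gtr_pMl.
    by exists c.
  pose c := \big[Num.max/c0']_i g i.
  have Cc : C c.
    by rewrite /c; elim/big_ind : _ => // [x y|i _]; [case: leP|case: (Hg i)].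
  exists c => //; split.
    by rewrite (le_trans (ltW lc0'))//; exact: bigmax_ge_id.
  move=> i; have [Cg /ltW lg] := Hg i; apply: le_trans lg _; apply: m_mono => //.
  exact: le_bigmax_cond.
(* A violation at [(cs, bs)] would persist at [(l cs, l bs)] for some [l < 1], by continuity along
   the ray. But some admissible [c] has [c >= l cs] and [m c >= l bs], so that [F] at the scaled
   point is at most [F c (m c) = m c <= bs]. *)
have bs_super : supersol cs bs.
  split=> [i|i]; first exact: ltW.
  rewrite leNgt; apply/negP => bF.
  pose f (l : R) := (cs * l) ^+ gamma i * phi zeta i (fun j => bs j * l).
  have f1 : f @ (1 : R) --> F cs bs i.
    apply: cvgM; last by apply: phi_scale_continuous => // j; exact: ltW.
    have : (fun l : R => (cs * l) ^+ gamma i) @ (1 : R) --> (cs * 1) ^+ gamma i;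
      last by rewrite mulr1.
    apply: (@continuous_comp R R R (fun l => cs * l) (fun x => x ^+ gamma i) 1).
      exact: mulrl_continuous.
    exact: exprn_continuous.
  have := cvg_at_left_filter f1 => {}f1.
  have : \forall l \near (1 : R)^'-, bs i < f l /\ 0 < l < 1.
    near=> l; split; first by near: l; exact: cvgr_gt bF.
    by apply/andP; split; near: l; [exact: nbhs_left_gt|exact: nbhs_left_lt].
  move=> H; have [l [bf l01]] := @filter_ex _ _ (at_left_proper_filter (1 : R)) _ H.
  have [c Cc [lc lm]] := near_sup l l01.
  have l0 : 0 <= l by case/andP: l01 => /ltW.
  suff : f l <= bs i by rewrite leNgt bf.
  apply: le_trans (m_bs c i Cc); rewrite -m_fix//.
  apply: F_le.
  - by rewrite mulr_ge0// ltW.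
  - by rewrite mulrC.
  - by move=> j; rewrite mulr_ge0// ltW.
  - by move=> j; rewrite mulrC.
have Ccs : C cs by split; [exact: ltW|exists bs].
exists cs, (m cs); split=> //.
- by move=> i; rewrite -m_fix//; apply: F_gt0 => // j; exact: m_ge0.
- by move=> i; exact: m_fix.
- by move=> b' b's i; exact: m_le.
- move=> c' b' c'b'; have [c'0|/ltW c'0] := leP 0 c'.
    by apply: ub_le_sup => //; split => //; exists b'.
  by rewrite (le_trans c'0)// ltW.
Unshelve. all: by end_near.
Qed.

(** The chord of a convex function on [0, 1]; it converts slack in the system into an explicit
    increase of [c]. *)
Let expr1D_le (t : R) n : 0 <= t <= 1 -> (1 + t) ^+ n <= 1 + t * (2 ^+ n - 1).
Proof.
move=> /andP[t0 t1]; elim: n => [|n ih]; first by rewrite !expr0 subrr mulr0 addr0.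
rewrite !exprS; set a := 2 ^+ n in ih *; set x := _ ^+ n in ih *.
have a1 : 1 <= a by rewrite exprn_ege1// ler1n.
apply: le_trans (_ : (1 + t) * (1 + t * (a - 1)) <= _).
  by rewrite ler_wpM2l// addr_ge0.
have : 0 <= t * (1 - t) * (a - 1) by rewrite !mulr_ge0// subr_ge0.
by rewrite -subr_ge0 => h; rewrite -subr_ge0; move: h; rewrite subr0; lra.
Qed.

Lemma exists_critical_tilt : exists c b, [/\ 0 < c, forall i, 0 < b i,
  forall i, c ^+ gamma i * phi zeta i b = b i &
  spectral_radius (mean_mx (tilt zeta b)) = 1].
Proof.
have [c [b [c0 b0 Fb b_min c_max]]] := exists_extremal.
exists c, b; split => //.
have t0 := tilt_ge0 z0 ez znil b0.
have Q0 i (y : 'cV[R]_K) : (forall j, 0 <= y j 0) ->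
    0 < phi (tilt zeta b) i (fun j => 1 + y j 0).
  move=> y0; apply: (@lt_le_trans _ _ (phi (tilt zeta b) i (fun=> 1))).
    by rewrite phi_tilt1.
  apply: phi_le => //; first exact: tilt_entire.
  by move=> j; rewrite lerDl.
have M0 := mean_mx_nneg t0.
have Fy i y c' : (forall j, 0 <= y j) -> F c' (fun j => b j * y j) i =
    c' ^+ gamma i * phi zeta i b * phi (tilt zeta b) i y.
  by move=> y0; rewrite /F phi_tilt// mulrA.
have Fc i : c ^+ gamma i * phi zeta i b = b i by exact: Fb.
apply/le_anti/andP; split.
  apply: spectral_radius_le => // l /(eigenvalue_col M0)[y [y0 [k yk]] My].
  set s := Normc.normc l in My *; rewrite leNgt; apply/negP => s1.
  (* The first term keeps the quadratic error below the gain [(s - 1) * y i 0], the second keeps the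
     new point nonnegative. Where [y i 0 = 0] the coordinate does not move and monotonicity of [phi]
     suffices, hence no constraint. *)
  pose g i := if 0 < y i 0 then
     Num.min ((s - 1) * y i 0 / phi (tilt zeta b) i (fun j => 1 + y j 0)) (y i 0)^-1 else 1.
  pose e := \big[Num.min/1]_i g i.
  have e_gt0 : 0 < e.
    apply: lt_bigmin => // i _; rewrite /g; case: ifP => // yi.
    have Qi := Q0 i y y0.
    rewrite lt_min; apply/andP; split; last by rewrite invr_gt0.
    by apply: divr_gt0 => //; apply: mulr_gt0 => //; rewrite subr_gt0.
  have e_le1 : e <= 1 by exact: bigmin_le_id.
  have e_le i : e <= g i by exact: bigmin_le_cond.
  have ey i : 0 <= 1 + - e * y i 0.
    rewrite mulNr subr_ge0; have := e_le i; rewrite /g; case: ifPn => [yi|].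
      by rewrite le_min => /andP[_]; rewrite -(ler_pM2r yi) mulVf// gt_eqF.
    by rewrite -leNgt => yi _; rewrite (_ : y i 0 = 0) ?mulr0//; apply/le_anti; rewrite yi y0.
  have ss : supersol c (fun j => b j * (1 + - e * y j 0)).
    split=> i; first by rewrite mulr_ge0// ltW.
    rewrite Fy// Fc ler_pM2l//; have := e_le i; rewrite /g; case: ifPn => [yi|].
      rewrite le_min => /andP[+ _]; rewrite ler_pdivlMr ?Q0// => eQ.
      have e1 : `|- e| <= 1 by rewrite normrN gtr0_norm.
      apply: le_trans (tilt_perturb z0 ez znil b0 i y0 e1) _.
      rewrite sqrrN -addrA lerD2l mulNr mulNr -[leRHS]mulNr.
      have := My i; rewrite -(ler_pM2l e_gt0) => eM.
      rewrite -(ler_pM2l e_gt0) in eQ; lra.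
    rewrite -leNgt => yi _; have yi0 : y i 0 = 0 by apply/le_anti; rewrite yi y0.
    rewrite yi0 mulr0 addr0 -[leRHS](phi_tilt1 z0 ez znil b0 i); apply: phi_le => //.
      exact: tilt_entire.
    by move=> j; rewrite mulNr gerBl mulr_ge0// ltW.
  have := b_min _ ss k; rewrite leNgt => /negP; apply.
  by rewrite gtr_pMr// mulNr gtrBl mulr_gt0.
rewrite leNgt; apply/negP => /(spectral_radius_lt M0 ltr01)[y y_gt0 My].
have y0 j : 0 <= y j 0 by exact: ltW.
pose Q i := phi (tilt zeta b) i (fun j => 1 + y j 0).
(* Using only half of the slack keeps [F c b' i < b' i] strict, which leaves room to raise [c]. *)
pose e := \big[Num.min/1]_i ((y i 0 - (mean_mx (tilt zeta b) *m y) i 0) / (Q i *+ 2)).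
have e_gt0 : 0 < e.
  apply: lt_bigmin => // i _; rewrite divr_gt0 ?pmulrn_lgt0 ?Q0// subr_gt0.
  by have := My i; rewrite mul1r.
have e_le1 : e <= 1 by exact: bigmin_le_id.
have ep j : 0 <= 1 + e * y j 0 by rewrite addr_ge0// mulr_ge0// ltW.
pose b' j := b j * (1 + e * y j 0).
have b'0 j : 0 <= b' j by rewrite mulr_ge0// ltW.
have F0 i : 0 < F c b' i by apply: F_gt0.
have Fb' i : F c b' i < b' i.
  rewrite Fy// Fc ltr_pM2l//.
  have e1 : `|e| <= 1 by rewrite gtr0_norm.
  apply: le_lt_trans (tilt_perturb z0 ez znil b0 i y0 e1) _.
  rewrite -addrA ltrD2l -/(Q i).
  have := My i; rewrite mul1r => Myi.
  have : e <= (y i 0 - (mean_mx (tilt zeta b) *m y) i 0) / (Q i *+ 2).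
    exact: bigmin_le_cond.
  rewrite ler_pdivlMr ?pmulrn_lgt0 ?Q0// => H.
  have eQ : e * Q i < y i 0 - (mean_mx (tilt zeta b) *m y) i 0.
    have := Q0 i y y0; rewrite -/(Q i) -(pmulr_rgt0 _ e_gt0) => eQ0.
    by apply: lt_le_trans H; rewrite mulrnAr mulr2n ltrDl.
  rewrite -(ltr_pM2l e_gt0) in eQ; lra.
(* Chosen so that [(1 + t) ^+ gamma i <= 1 + t * (2 ^+ gamma i - 1) <= b' i / F c b' i]. *)
pose t := \big[Num.min/1]_i ((b' i / F c b' i - 1) / 2 ^+ gamma i).
have t_gt0 : 0 < t.
  apply: lt_bigmin => // i _; rewrite divr_gt0 ?exprn_gt0// subr_gt0.
  by rewrite ltr_pdivlMr// mul1r.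
have t_le1 : t <= 1 by exact: bigmin_le_id.
have ss : supersol (c * (1 + t)) b'.
  split=> // i; rewrite /F exprMn mulrAC -ler_pdivlMl; last exact: F0.
  apply: le_trans (expr1D_le _ _) _; first by rewrite ltW.
  have H : t <= (b' i / F c b' i - 1) / 2 ^+ gamma i by exact: bigmin_le_cond.
  rewrite ler_pdivlMr ?exprn_gt0// in H.
  rewrite -/(F c b' i) [leRHS]mulrC; lra.
have := c_max _ _ ss; rewrite leNgt => /negP; apply.
by rewrite ltr_pMr// ltrDl.
Qed.

End critical_tilt.

(** * The law of Galton-Watson trees *)

Section countable_union.
Context {d : measure_display} {Omega : measurableType d} {T : countType}.
Variables (D : set T) (F : T -> set Omega).
Hypothesis mF : forall t, D t -> measurable (F t).

Let G n := if @choice.unpickle T n is Some t then F t else set0.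

Let GE t : G (choice.pickle t) = F t. Proof. by rewrite /G choice.pickleK. Qed.

Let bigcupE : \bigcup_(t in D) F t = \bigcup_(n in choice.pickle @` D) G n.
Proof. by rewrite bigcup_image; apply: eq_bigcupr => t _; rewrite GE. Qed.

Lemma bigcup_countable_measurable : measurable (\bigcup_(t in D) F t).
Proof.
by rewrite bigcupE; apply: bigcup_measurable => _ [t Dt <-]; rewrite GE; exact: mF.
Qed.

Lemma measure_bigcup_countable {R : realType} (P : probability Omega R) :
  trivIset D F -> P (\bigcup_(t in D) F t) = (\esum_(t in D) P (F t))%E.
Proof.
move=> tF; rewrite bigcupE measure_bigcup; first last.
- move=> _ _ [t Dt <-] [t' Dt' <-]; rewrite !GE => h.
  by congr choice.pickle; exact: tF h.
- by move=> _ [t Dt <-]; rewrite GE; exact: mF.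
rewrite nneseries_esum; last by move=> n _; exact: measure_ge0.
rewrite set_mem_set esum_image; last first.
  by move=> t t' _ _; exact: (pcan_inj choice.pickleK).
by apply: eq_esum => t _; rewrite GE.
Qed.

End countable_union.

(** * Finite trees as cylinder events *)

Section codes.
Context {K : nat}.
Implicit Types (x y : seq nat * 'I_K -> seq 'I_K) (i j : 'I_K).

Definition ttype x i u : 'I_K := odflt i (grow x i u).

Definition key x i u : seq nat * 'I_K := (u, ttype x i u).

Definition tverts x i : seq (seq nat) := enum_fset (fset_set (vertices (grow x i))).

(* The list of the children lists of all the vertices: it determines a finite
   tree, and is a value of a countable type. *)
Definition code x i : seq ((seq nat * 'I_K) * seq 'I_K) :=
  [seq (key x i u, x (key x i u)) | u <- tverts x i].

Definition tfinite x i := finite_set (vertices (grow x i)).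

Lemma tvertsP x i u : tfinite x i -> (u \in tverts x i) = (grow x i u != None).
Proof.
move=> fx; rewrite -[LHS]/(u \in fset_set (vertices (grow x i))) in_fset_set//.
by apply/idP/idP => [/set_mem/eqP|/eqP ?]; [|exact/mem_set].
Qed.

Lemma uniq_tverts x i : uniq (tverts x i).
Proof. exact: fset_uniq. Qed.

Lemma grow_key x i u j : grow x i u = Some j -> key x i u = (u, j).
Proof. by rewrite /key /ttype => ->. Qed.

(** Growing a tree reads [x] only at its own vertices, so a finite tree is decided by finitely many
    coordinates. *)
Lemma code_agree x y i : tfinite x i ->
  (forall p, p \in code x i -> y p.1 = p.2) -> grow y i = grow x i.
Proof.
move=> fx xy; apply/funext; elim=> [//|n v /= ->].
case E : (grow x i v) => [j|//].
have vx : v \in tverts x i by rewrite tvertsP// E.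
have /xy/= := map_f (fun u => (key x i u, x (key x i u))) vx.
by rewrite (grow_key E) => ->.
Qed.

Lemma code_eq x y i : tfinite x i ->
  (forall p, p \in code x i -> y p.1 = p.2) -> code y i = code x i.
Proof.
move=> fx xy; have gE := code_agree fx xy.
rewrite /code /tverts gE; apply/eq_in_map => u ux.
have /xy/= := map_f (fun u => (key x i u, x (key x i u))) ux.
by rewrite /key /ttype gE => ->.
Qed.

Lemma uniq_code_keys x i : uniq [seq p.1 | p <- code x i].
Proof.
rewrite /code -map_comp map_inj_in_uniq ?uniq_tverts// => u v _ _ /=.
by rewrite /key => -[].
Qed.

Lemma code_val x i p : p \in code x i -> x p.1 = p.2.
Proof. by move=> /mapP[u _ ->]. Qed.

Lemma code_tree x y i : grow y i = grow x i -> tfinite x i -> code y i = code x i.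
Proof.
move=> gE fx; rewrite /code /tverts gE; apply/eq_in_map => u.
rewrite -[_ \in _]/(u \in tverts x i) tvertsP// => ux.
rewrite /key /ttype gE; case E : (grow x i u) ux => [j|//] _ /=.
congr pair; apply: eq_from_onth => n.
have := congr1 (fun t => t (n :: u)) gE; rewrite /= E.
by have := congr1 (fun t => t u) gE; rewrite E => ->.
Qed.

Definition tree_codes i (S : set (ptree K)) : set (seq ((seq nat * 'I_K) * seq 'I_K)) :=
  [set code x i | x in [set x | S (grow x i)]].

Lemma tverts_perm x i : tfinite x i ->
  perm_eq (tverts x i)
    ([::] :: [seq n :: v | v <- tverts x i, n <- iota 0 (size (x (key x i v)))]).
Proof.
move=> fx; apply: uniq_perm; first exact: uniq_tverts.
  rewrite /=; apply/andP; split; first by apply/allpairsPdep => -[v [n []]].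
  apply: allpairs_uniq_dep; first exact: uniq_tverts.
    by move=> v _; exact: iota_uniq.
  by move=> [v n] [v' n'] _ _ /= [-> ->].
move=> u; rewrite inE tvertsP//; case: u => [//|n v] /=.
apply/idP/idP => [|/allpairsPdep[v' [n' []]]].
  case E : (grow x i v) => [j|//] nj; apply/allpairsPdep; exists v, n; split=> //.
    by rewrite tvertsP// E.
  by rewrite mem_iota (grow_key E)/= -onthTE; case: onth nj.
rewrite tvertsP// mem_iota/= => v'x n'x [-> ->].
case E : (grow x i v') v'x => [j|//] _; rewrite (grow_key E) -onthTE in n'x.
by case: onth n'x.
Qed.

Definition type_word x i : seq 'I_K := [seq ttype x i u | u <- tverts x i].

Lemma ntypeE x i j : tfinite x i -> ntype (grow x i) j = count_mem j (type_word x i).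
Proof.
move=> fx; rewrite /type_word count_map -size_filter /ntype -[LHS]/(size _).
have fj : finite_set [set u | grow x i u = Some j].
  by apply: sub_finite_set fx => u /= uj; rewrite /vertices/= uj.
apply: perm_size; apply: uniq_perm.
- exact: fset_uniq.
- by rewrite filter_uniq// uniq_tverts.
move=> u; rewrite mem_filter tvertsP//.
rewrite -[LHS]/(u \in fset_set [set u | grow x i u = Some j]) in_fset_set//.
apply/idP/idP => [/set_mem/= uj|/andP[/= /eqP <-]].
  by rewrite /ttype uj eqxx.
by rewrite /ttype => uN; apply/mem_set => /=; case: grow uN.
Qed.

(* Every vertex but the root is a child of exactly one vertex. *)
Lemma prod_children {R : comPzRingType} x i (f : 'I_K -> R) : tfinite x i ->
  f i * \prod_(p <- code x i) \prod_(c <- p.2) f c =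
  \prod_(c <- type_word x i) f c.
Proof.
move=> fx; rewrite /type_word big_map [RHS](perm_big _ (tverts_perm fx))/=.
rewrite big_cons big_allpairs_dep/= /code big_map/=; congr (_ * _).
apply: eq_big_seq => v; rewrite tvertsP// => vx.
rewrite (big_nth i) /index_iota subn0; apply: eq_big_seq => n; rewrite mem_iota/= => nx.
congr f; rewrite /ttype/=; case E : (grow x i v) vx nx => [j|//] _.
rewrite (grow_key E) => nx; rewrite -odflt_onth.
by case: onth (onthTE (x (v, j)) n) => //; rewrite nx.
Qed.

End codes.

Section bgw_law.
Context {R : realType} {K : nat}.
Variable zeta : 'I_K -> seq 'I_K -> R.

Definition code_weight (s : seq ((seq nat * 'I_K) * seq 'I_K)) : R :=
  \prod_(p <- s) zeta p.1.2 p.2.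

Context {d : measure_display} {Omega : measurableType d}.
Variables (P : probability Omega R) (xi : seq nat * 'I_K -> Omega -> seq 'I_K).
Hypothesis xiP : offspring_family zeta P xi.

Let code_event (s : seq ((seq nat * 'I_K) * seq 'I_K)) : set Omega :=
  [set o | forall p, p \in s -> xi p.1 o = p.2].

Let code_event_sub i S s : (forall t, S t -> finite_set (vertices t)) ->
  tree_codes i S s ->
  code_event s `<=` [set o | S (bgw xi i o) /\ code (xi ^~ o) i = s].
Proof.
move=> fS [x /= Sx <-] o Eo; split.
  by rewrite /bgw (code_agree (fS _ Sx) Eo).
exact: code_eq (fS _ Sx) Eo.
Qed.

Let bgw_preimage i (S : set (ptree K)) : (forall t, S t -> finite_set (vertices t)) ->
  bgw xi i @^-1` S = \bigcup_(s in tree_codes i S) code_event s.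
Proof.
move=> fS; apply/seteqP.
split=> [ o So| o [s Ss /(code_event_sub fS Ss)[]//]].
exists (code (xi ^~ o) i); first by exists (xi ^~ o).
by move=> p; exact: code_val.
Qed.

Let code_event_measurable s : measurable (code_event s).
Proof.
case: xiP => mxi _ _.
rewrite (_ : code_event s = \bigcap_(p in [set` s]) (xi p.1 @^-1` [set p.2])).
  by apply: fin_bigcap_measurable => // p _; exact: mxi.
by apply/seteqP; split => o H p /H.
Qed.

Lemma bgw_measurable i (S : set (ptree K)) :
  (forall t, S t -> finite_set (vertices t)) -> measurable (bgw xi i @^-1` S).
Proof.
move=> fS; rewrite bgw_preimage//; apply: bigcup_countable_measurable => s _.
exact: code_event_measurable.
Qed.

(** The event of a given code is a cylinder on distinct keys, so independence turns its probability
    into a product; codes are countably many and their events disjoint. *)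
Lemma bgw_law i (S : set (ptree K)) : (forall t, S t -> finite_set (vertices t)) ->
  P (bgw xi i @^-1` S) = (\esum_(s in tree_codes i S) (code_weight s)%:E)%E.
Proof.
move=> fS; case: (xiP) => _ lxi ixi; rewrite bgw_preimage//.
rewrite measure_bigcup_countable//; last first.
  move=> s s' Ss Ss' [ o [/(code_event_sub fS Ss)[_ <-]]].
  by move=> /(code_event_sub fS Ss')[_ <-].
apply: eq_esum => _ [x Sx <-].
have -> : code_event (code x i) =
    [set o | forall a, a \in [seq p.1 | p <- code x i] -> xi a o = x a].
  apply/seteqP; split=> o /= H.
    by move=> _ /mapP[p px ->]; rewrite H// (code_val px).
  by move=> p px; rewrite H ?(code_val px)//; exact: map_f.
rewrite ixi ?uniq_code_keys// big_map /code_weight -prodEFin.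
apply: eq_big_seq => -[[u j] w] px.
by rewrite lxi/= (code_val px).
Qed.

End bgw_law.

(** * Tilts are equivalent *)

Section equivalence_of_tilts.
Context {R : realType} {K : nat}.
Implicit Types (zeta : 'I_K -> seq 'I_K -> R) (a b : 'I_K -> R).

Definition gsize (gamma : 'I_K -> nat) (t : ptree K) : nat := \sum_j gamma j * ntype t j.

(* Each non-root vertex contributes b of its type through its parent, each
   vertex contributes a of its type, and a * b = c ^+ gamma. *)
Lemma code_weight_tilt zeta zeta' a b (c : R) (gamma : 'I_K -> nat) x i :
  (forall j w, zeta' j w = zeta j w * (a j * wprod b w)) ->
  (forall j, a j * b j = c ^+ gamma j) -> tfinite x i ->
  b i * code_weight zeta' (code x i) =
  c ^+ gsize gamma (grow x i) * code_weight zeta (code x i).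
Proof.
move=> zE abc fx; rewrite /code_weight.
under eq_bigr do rewrite zE.
rewrite !big_split/=.
have -> : \prod_(p <- code x i) a p.1.2 = wprod a (type_word x i).
  by rewrite /code /type_word /wprod !big_map.
have := prod_children b fx; rewrite -[X in _ = X]/(wprod b _).
set W := \prod_(p <- _) zeta _ _; set B := \prod_(p <- _) _ => BE.
transitivity (W * (wprod a (type_word x i) * (b i * B))); first by ring.
rewrite BE -wprodM [RHS]mulrC; congr (_ * _).
have -> : (fun j => a j * b j) = (fun j => c ^+ gamma j) by exact/funext.
rewrite wprod_fin /gsize; under eq_bigr do rewrite -exprM ffunE -ntypeE//.
by rewrite prodrXr.
Qed.

(** On the conditioning event the ratio of the two weights is the constant [c ^+ n / b i], which
    cancels in the conditional probabilities. *)
Lemma tilt_gamma_equivalent (L : nat) (Gamma : 'M[R]_(L, K))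
    zeta zeta' a b (c : R) (gamma : 'I_K -> nat) :
  (forall j w, 0 <= zeta j w) -> (forall j, 0 < a j) -> (forall j, 0 < b j) ->
  0 < c ->
  (forall j w, zeta' j w = zeta j w * (a j * wprod b w)) ->
  (forall j, a j * b j = c ^+ gamma j) ->
  ker_orthogonal Gamma (\col_j (gamma j)%:R) ->
  gamma_equivalent Gamma zeta zeta'.
Proof.
move=> z0 a0 b0 c0 zE abc kG; split=> [w i|].
  have ab : a i * wprod b w != 0 by rewrite mulf_neq0 ?gt_eqF ?wprod_gt0.
  by rewrite zE; split=> [->|/eqP]; rewrite ?mul0r// mulf_eq0 (negbTE ab) orbF => /eqP.
move=> i g d d' Omega Omega' P P' xi xi' xiP xi'P Pg A.
have fS B : forall t, (cond_set Gamma g `&` B) t -> finite_set (vertices t).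
  by move=> t [[]].
have z'0 j w : 0 <= zeta' j w.
  by rewrite zE mulr_ge0// mulr_ge0 ?ltW// wprod_gt0.
have wt0 z s : (forall j w, 0 <= z j w) -> 0 <= code_weight z s :> R.
  by move=> z00; rewrite /code_weight prodr_ge0.
(* The type counts of two trees of the event differ by a kernel vector, to which [gamma] is
   orthogonal. If no tree qualifies, any [n] will do. *)
have [n gn] : exists n, forall x, cond_set Gamma g (grow x i) ->
    gsize gamma (grow x i) = n.
  have [[x [fx gx]]|nx] := pselect (exists x, cond_set Gamma g (grow x i)); last first.
    by exists 0%N => x xg; exfalso; apply: nx; exists x.
  exists (gsize gamma (grow x i)) => y [fy gy].
  have := kG ((\col_j (ntype (grow y i) j)%:R) - (\col_j (ntype (grow x i) j)%:R)).
  rewrite mulmxBr gx gy subrr => /(_ erefl).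
  under eq_bigr do rewrite !mxE mulrBr -!natrM.
  rewrite sumrB -!natr_sum => /eqP; rewrite subr_eq0 eqr_nat => /eqP.
  by [].
pose k := c ^+ n / b i.
have k0 : 0 < k by rewrite divr_gt0 ?exprn_gt0.
have E B : P' (bgw xi' i @^-1` (cond_set Gamma g `&` B)) =
    (k%:E * P (bgw xi i @^-1` (cond_set Gamma g `&` B)))%E.
  rewrite (bgw_law xi'P i (fS B)) (bgw_law xiP i (fS B)).
  rewrite -esumZl//; [|exact: ltW|by move=> s; exact: wt0].
  apply: eq_esum => _ [x [xg _] <-]; congr EFin.
  rewrite /k -(gn x xg) mulrAC.
  rewrite -(code_weight_tilt zE abc); last by case: xg.
  by rewrite mulrAC divff ?mul1r// gt_eqF.
have EA := E A; have ET := E setT; rewrite setIT in ET.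
rewrite /cond_law EA ET.
have fk (y : \bar R) : fine (k%:E * y)%E = k * fine y.
  by case: y => [r||]; rewrite ?gt0_muley ?gt0_muleNy ?lte_fin//= mulr0.
by rewrite !fk -mulf_div divff ?mul1r// gt_eqF.
Qed.

End equivalence_of_tilts.

(** * Existence of an offspring family *)

Section unit_interval.
Context {R : realType}.

Let mI : measurable (`[0, 1[%classic : set (measurableTypeR R)).
Proof. exact: measurable_itv. Qed.

Definition unit_uniform : set (measurableTypeR R) -> \bar R :=
  mrestr (@lebesgue_measure R) mI.

HB.instance Definition _ := Measure.on unit_uniform.

Let unit_uniform_setT : unit_uniform setT = 1%E.
Proof.
rewrite /unit_uniform /mrestr setTI.
have := @lebesgue_measure_itv R `[0, 1[.
by rewrite /= lte_fin ltr01 oppr0 adde0.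
Qed.

HB.instance Definition _ := Measure_isProbability.Build _ _ R unit_uniform
  unit_uniform_setT.

Lemma unit_uniform_itv (a b : R) : 0 <= a -> a <= b -> b <= 1 ->
  unit_uniform `[a, b[%classic = (b - a)%:E.
Proof.
move=> a0 ab b1; rewrite /unit_uniform /mrestr setIidl; last first.
  by move=> x /=; rewrite !in_itv/= => /andP[ax xb]; rewrite (le_trans a0)//= (lt_le_trans xb).
have := @lebesgue_measure_itv R `[a, b[; rewrite /= lte_fin => ->.
case: ltP => [_|ba]; first by rewrite -EFinB.
by rewrite (_ : a = b) ?subrr//; apply/le_anti; rewrite ab.
Qed.

End unit_interval.

(* Digits of a point t of [0, 1[ in the expansion whose k-th digit has law
   q k: [0, 1[ is cut into intervals of lengths q 0 0, q 0 1, ..., the interval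
   containing t is the first digit, and it is blown up to [0, 1[. *)
Section digits.
Context {R : realType}.
Implicit Types (q : nat -> nat -> R) (t : R) (m : nat -> nat).

Definition cdf (p : nat -> R) n : R := \sum_(k < n) p k.

Definition digit0 (p : nat -> R) t : nat :=
  if pselect (exists n, t < cdf p n.+1) is left h then ex_minn h else 0.

Definition shift_point (p : nat -> R) t : R :=
  (t - cdf p (digit0 p t)) / p (digit0 p t).

Fixpoint digit q n t : nat :=
  if n is n'.+1 then digit (fun k => q k.+1) n' (shift_point (q 0) t)
  else digit0 (q 0) t.

Definition is_law (p : nat -> R) :=
  (forall n, 0 <= p n) /\ (\esum_(n in [set: nat]) (p n)%:E = 1)%E.

Lemma cdfS p n : cdf p n.+1 = cdf p n + p n.
Proof. by rewrite /cdf big_ord_recr. Qed.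

Lemma cdf_ge0 p n : is_law p -> 0 <= cdf p n.
Proof. by move=> [p0 _]; rewrite /cdf sumr_ge0. Qed.

Lemma cdf_mono p n k : is_law p -> (n <= k)%N -> cdf p n <= cdf p k.
Proof.
move=> [p0 _]; elim: k => [|k ih]; first by rewrite leqn0 => /eqP ->.
by rewrite leq_eqVlt => /orP[/eqP -> //|/ih h]; rewrite cdfS ler_wpDr.
Qed.

Lemma cdf_le1 p n : is_law p -> cdf p n <= 1.
Proof.
move=> [p0 p1]; rewrite -lee_fin -p1; apply: esum_ge.
exists `I_n; first by split; [exact: finite_II|].
by rewrite fsumEFin ?finite_II// /cdf fsbig_ord lexx.
Qed.

Lemma cdf_sup p t : is_law p -> t < 1 -> exists n, t < cdf p n.+1.
Proof.
move=> lp t1; apply: contrapT => h; have [p0 p1] := lp.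
have : (1 <= t%:E)%E; last by rewrite lee_fin leNgt t1.
rewrite -p1 -nneseries_esumT; last by move=> n; rewrite lee_fin.
apply: lime_le; first by apply: is_cvg_ereal_nneg_natsum => n _; rewrite lee_fin.
apply: nearW => n; rewrite sumEFin lee_fin big_mkord leNgt; apply/negP => tn.
apply: h; exists n; apply: lt_le_trans tn _.
exact: cdf_mono.
Qed.

Lemma digit0P p t k : is_law p -> 0 <= t < 1 ->
  (digit0 p t = k) <-> (cdf p k <= t < cdf p k.+1).
Proof.
move=> lp /andP[t0 t1]; rewrite /digit0; case: pselect => [h|/(_ (cdf_sup lp t1))//].
case: ex_minnP => n tn nmin; split=> [<-|/andP[kt tk]].
  rewrite tn andbT leNgt; apply/negP; case: n tn nmin => [|n] tn nmin.
    by rewrite /cdf big_ord0 ltNge t0.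
  by move=> /nmin; rewrite ltnn.
apply/eqP; rewrite eqn_leq nmin//= leqNgt; apply/negP => nk.
have := cdf_mono lp nk; rewrite leNgt => /negP; apply.
exact: le_lt_trans tn.
Qed.

(** [shift_point] is affine on the interval of the first digit, so pulling back the interval of the
    remaining digits multiplies its length by the probability of the first digit. A digit of
    probability 0 gives an empty interval. *)
Lemma cylinder q n m : (forall k, is_law (q k)) ->
  exists a, [/\ 0 <= a, a + \prod_(k < n) q k (m k) <= 1 &
    forall t, (0 <= t < 1 /\ (forall k, (k < n)%N -> digit q k t = m k)) <->
      a <= t < a + \prod_(k < n) q k (m k)].
Proof.
elim: n q m => [|n ih] q m lq.
  exists 0; rewrite big_ord0 add0r; split=> // t.
  by split=> [[]|].
have [a [a0 a1 aP]] := ih (fun k => q k.+1) (fun k => m k.+1) (fun k => lq k.+1).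
pose p := q 0%N; have lp : is_law p := lq 0%N.
pose l := \prod_(k < n) q k.+1 (m k.+1); rewrite -/l in a1 aP.
have l0 : 0 <= l by rewrite prodr_ge0// => k _; case: (lq k.+1).
have pm0 : 0 <= p (m 0%N) by case: lp.
have -> : \prod_(k < n.+1) q k (m k) = p (m 0%N) * l by rewrite big_ord_recl.
exists (cdf p (m 0%N) + p (m 0%N) * a); split.
- by rewrite addr_ge0 ?cdf_ge0// mulr_ge0.
- rewrite -addrA -mulrDr; apply: le_trans (cdf_le1 (m 0%N).+1 lp).
  by rewrite cdfS lerD2l ler_piMr.
move=> t; split.
  move=> [t01 H]; have /(digit0P (m 0%N) lp t01) := H 0%N isT.
  rewrite cdfS => /andP[ct tc].
  have p_gt0 : 0 < p (m 0%N) by move: (le_lt_trans ct tc); rewrite ltrDl.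
  have d0 : digit0 p t = m 0%N by exact: H 0%N isT.
  have /aP : 0 <= shift_point p t < 1 /\ forall k, (k < n)%N ->
      digit (fun k => q k.+1) k (shift_point p t) = m k.+1.
    split; last by move=> k kn; exact: H k.+1 kn.
    rewrite /shift_point d0 divr_ge0 ?subr_ge0//= ltr_pdivrMr// mul1r.
    by rewrite ltrBlDl.
  rewrite /shift_point d0 ler_pdivlMr// ltr_pdivrMr// => /andP[h1 h2].
  by apply/andP; split; lra.
move=> /andP[h1 h2].
have p_gt0 : 0 < p (m 0%N).
  rewrite lt_def pm0 andbT; apply/eqP => pE; move: (le_lt_trans h1 h2).
  by rewrite pE !mul0r !addr0 ltxx.
have t01 : 0 <= t < 1.
  rewrite (le_trans _ h1) ?addr_ge0 ?cdf_ge0 ?mulr_ge0//=.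
  apply: lt_le_trans h2 _; rewrite -addrA -mulrDr.
  apply: le_trans (cdf_le1 (m 0%N).+1 lp); by rewrite cdfS lerD2l ler_piMr.
have d0 : digit0 p t = m 0%N.
  apply/(digit0P _ lp t01); rewrite cdfS (le_trans _ h1) ?lerDl ?mulr_ge0//=.
  by apply: lt_le_trans h2 _; rewrite -addrA -mulrDr lerD2l ler_piMr.
have /aP[s01 H] : a <= shift_point p t < a + l.
  rewrite /shift_point d0 ler_pdivlMr// ltr_pdivrMr//.
  by apply/andP; split; lra.
by split=> // -[|k] kn //=; exact: H.
Qed.

(** Half-open intervals of length 0 are empty, so digits of probability 0 occur nowhere, not merely
    almost nowhere. *)
Lemma digit_gt0 q k t : (forall k, is_law (q k)) -> 0 <= t < 1 ->
  0 < q k (digit q k t).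
Proof.
move=> lq t01; have [a [_ _ aP]] := cylinder k.+1 (digit q ^~ t) lq.
have /aP : 0 <= t < 1 /\ forall k', (k' < k.+1)%N -> digit q k' t = digit q k' t by [].
rewrite big_ord_recr/= => /andP[h1 h2]; rewrite lt_def.
have [-> _] := lq k; rewrite andbT; apply/eqP => q0.
by move: (le_lt_trans h1 h2); rewrite q0 mulr0 addr0 ltxx.
Qed.

Definition digit_set q n (r : seq nat) m : set (measurableTypeR R) :=
  [set t | 0 <= t < 1 /\
    forall k, (k < n)%N -> k \notin r -> digit q k t = m k].

(** [r] lists the positions below [n] that are left free. Freeing one more position means summing
    over its values, whose probabilities add up to 1; independence of the first [n] digits thus
    passes to arbitrary finite subfamilies. *)
Lemma digit_set_law q n r m : (forall k, is_law (q k)) -> uniq r ->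
  (forall k, k \in r -> (k < n)%N) ->
  measurable (digit_set q n r m) /\
  unit_uniform (digit_set q n r m) = (\prod_(k < n | (k : nat) \notin r) q k (m k))%:E.
Proof.
move=> lq; elim: r m => [|k0 r ih] m.
  move=> _ _; have [a [a0 a1 aP]] := cylinder n m lq.
  set l := \prod_(k < n) _ in a1 aP.
  have l0 : 0 <= l by rewrite prodr_ge0// => k _; case: (lq k).
  have -> : digit_set q n [::] m = `[a, a + l[%classic.
    apply/seteqP; split=> t /=.
      by move=> [t01 H]; rewrite in_itv/=; apply/aP; split=> // k kn; exact: H.
    by rewrite in_itv/= => /aP[t01 H]; split=> // k kn _; exact: H.
  split; first exact: measurable_itv.
  by rewrite unit_uniform_itv// ?lerDl// addrAC subrr add0r.
move=> /= /andP[k0r ur] rn.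
have k0n : (k0 < n)%N by rewrite rn// mem_head.
have {}rn k : k \in r -> (k < n)%N by move=> kr; rewrite rn// in_cons kr orbT.
pose m' v k := if k == k0 then v else m k.
have -> : digit_set q n (k0 :: r) m = \bigcup_(v in [set: nat]) digit_set q n r (m' v).
  apply/seteqP; split=> t.
    move=> [t01 H]; exists (digit q k0 t) => //; split=> // k kn kr.
    by rewrite /m'; case: eqVneq => [->//|kk0]; rewrite H// in_cons negb_or kk0.
  move=> [v _ [t01 H]]; split=> // k kn; rewrite in_cons negb_or => /andP[kk0 kr].
  by rewrite H// /m' (negbTE kk0).
have mD v := (ih (m' v) ur rn).1; have lD v := (ih (m' v) ur rn).2.
split; first by apply: bigcup_measurable => v _; exact: mD.
rewrite measure_bigcup_countable; first last.
- move=> v v' _ _ [t [[_ /(_ k0 k0n k0r) +] [_ /(_ k0 k0n k0r)]]].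
  by rewrite /m' eqxx => -> ->.
- by move=> v _; exact: mD.
pose C := \prod_(k < n | (k : nat) \notin k0 :: r) q k (m k).
have C0 : 0 <= C by rewrite prodr_ge0// => k _; case: (lq k).
transitivity (\esum_(v in [set: nat]) (C * q k0 v)%:E)%E.
  apply: eq_esum => v _; rewrite -[LHS]/(unit_uniform _) lD; congr EFin.
  rewrite (bigD1 (Ordinal k0n))//= {1}/m' eqxx mulrC; congr (_ * _).
  apply: eq_big => [k|k]; first by rewrite in_cons negb_or andbC -val_eqE.
  by move=> /andP[_ kk0]; rewrite /m' (negbTE (_ : (k : nat) != k0)).
have [qk0 qk1] := lq k0.
by rewrite esumZl// qk1 mule1.
Qed.

End digits.

Section offspring_existence.
Context {R : realType} {K : nat}.
Variable zeta : 'I_K -> seq 'I_K -> R.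
Hypothesis pz : prob_family zeta.
Variable j0 : 'I_K.

(** The default [j0] gives an honest law to the digits whose index codes no pair, as the expansion
    needs a law at every index. *)
Let vertex_type (n : nat) : 'I_K :=
  if @choice.unpickle (seq nat * 'I_K)%type n is Some a then a.2 else j0.

Let q n m : R :=
  if @choice.pickle_inv (seq 'I_K) m is Some w then zeta (vertex_type n) w else 0.

Let q_law n : is_law (q n).
Proof.
have [z0 z1] := pz; split=> [m|]; first by rewrite /q; case: choice.pickle_inv.
rewrite -(z1 (vertex_type n)).
have -> : \esum_(w in [set: seq 'I_K]) (zeta (vertex_type n) w)%:E =
    \esum_(w in [set: seq 'I_K]) (q n (choice.pickle w))%:E.
  by apply: eq_esum => w _; rewrite /q choice.pickleK_inv.
rewrite -(@esum_image _ _ _ setT (@choice.pickle (seq 'I_K)) (fun m => (q n m)%:E)); last first.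
  by move=> w w' _ _; exact: (pcan_inj choice.pickleK).
rewrite [RHS]esum_mkcond; apply: eq_esum => m _; case: ifPn => // /negP mN.
rewrite /q; have := @choice.pickle_invK (seq 'I_K) m; case: choice.pickle_inv => //= w wm.
by exfalso; apply: mN; apply/mem_set; exists w.
Qed.

(** The sample space is the whole line, with a measure carried by [[0, 1[]; hence the value fixed
    outside. *)
Let xi (a : seq nat * 'I_K) (t : measurableTypeR R) : seq 'I_K :=
  if 0 <= (t : R) < 1 then
    odflt [::] (choice.pickle_inv (digit q (choice.pickle a) t)) else [::].

Let xiE a t w : 0 <= (t : R) < 1 ->
  (xi a t = w) <-> (digit q (choice.pickle a) t = choice.pickle w).
Proof.
move=> t01; rewrite /xi t01; have := digit_gt0 (choice.pickle a) q_law t01.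
rewrite {1}/q; case E : choice.pickle_inv => [w'|]; last by rewrite ltxx.
have := @choice.pickle_invK (seq 'I_K) (digit q (choice.pickle a) t).
rewrite E/= => <- _; split=> [->//|]; exact: (pcan_inj choice.pickleK).
Qed.

Let xi_set (s : seq (seq nat * 'I_K)) (w : seq nat * 'I_K -> seq 'I_K) :
  uniq s ->
  measurable ([set t | forall a, a \in s -> xi a t = w a] `&` `[0, 1[%classic) /\
  unit_uniform [set t | forall a, a \in s -> xi a t = w a] =
  (\prod_(a <- s) zeta a.2 (w a))%:E.
Proof.
move=> us; pose n := (\max_(a <- s) choice.pickle a).+1.
pose ks := map choice.pickle s.
have ksn k : k \in ks -> (k < n)%N.
  by move=> /mapP[a sa ->]; rewrite /n ltnS; exact: leq_bigmax_seq.
have uks : uniq ks.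
  by rewrite map_inj_uniq//; exact: (pcan_inj choice.pickleK).
pose r := [seq k <- iota 0 n | k \notin ks].
pose m k := if @choice.unpickle (seq nat * 'I_K)%type k is Some a
  then choice.pickle (w a) else 0%N.
have mE a : m (choice.pickle a) = choice.pickle (w a) by rewrite /m choice.pickleK.
have rP k : (k < n)%N -> (k \notin r) = (k \in ks).
  by move=> kn; rewrite mem_filter mem_iota/= add0n kn andbT negbK.
have [|mA lA] := @digit_set_law R q n r m q_law (filter_uniq _ (iota_uniq _ _)).
  by move=> k; rewrite mem_filter mem_iota => /andP[_ /andP[]].
have E : [set t | forall a, a \in s -> xi a t = w a] `&` `[0, 1[%classic =
    digit_set q n r m.
  apply/seteqP; split=> t /=.
    rewrite in_itv/= => -[H t01]; split=> // k kn; rewrite rP// => /mapP[a sa ->].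
    by rewrite mE; apply/xiE => //; exact: H.
  move=> [t01 H]; rewrite in_itv/=; split=> // a sa; apply/xiE => //.
  by rewrite -mE H ?rP// ?ksn// map_f.
split; first by rewrite E.
have -> : unit_uniform [set t | forall a, a \in s -> xi a t = w a] =
    unit_uniform (digit_set q n r m).
  by rewrite -E /unit_uniform /mrestr -setIA setIid.
rewrite lA; congr EFin.
rewrite -(big_mkord (fun k => k \notin r) (fun k => q k (m k))).
rewrite -big_filter; transitivity (\prod_(k <- ks) q k (m k)).
  apply: perm_big; apply: uniq_perm => //; first by rewrite filter_uniq// iota_uniq.
  move=> k; rewrite mem_filter mem_index_iota/=.
  have [kn|nk] := ltnP k n; first by rewrite rP// andbT.
  by rewrite andbF; apply/esym/negP => /ksn; rewrite ltnNge nk.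
rewrite /ks big_map; apply: eq_bigr => a _.
by rewrite mE /q choice.pickleK_inv /vertex_type choice.pickleK.
Qed.

Lemma exists_offspring_family : exists (d : measure_display)
  (Omega : measurableType d) (P : probability Omega R)
  (X : seq nat * 'I_K -> Omega -> seq 'I_K), offspring_family zeta P X.
Proof.
exists _, (measurableTypeR R), unit_uniform, xi.
have one a w : xi a @^-1` [set w] =
    [set t | forall a', a' \in [:: a] -> xi a' t = (fun=> w) a'].
  apply/seteqP; split=> t /= => [<- a'|H]; first by rewrite inE => /eqP ->.
  by apply: H; rewrite inE.
have law1 a w : unit_uniform (xi a @^-1` [set w]) = (zeta a.2 w)%:E.
  by rewrite one (xi_set (fun=> w) _).2// big_seq1.
split=> [a w|u j w|s w us]; last 2 first.
- exact: law1.
- rewrite -[LHS]/(unit_uniform _) (xi_set w us).2 -prodEFin.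
  by apply: eq_bigr => a _; exact/esym/law1.
have -> : xi a @^-1` [set w] = (xi a @^-1` [set w] `&` `[0, 1[%classic) `|`
    (~` `[0, 1[%classic `&` [set t | w = [::]]).
  apply/seteqP; split=> t /=.
    move=> xw; have [tI|tI] := pselect (t \in `[0, 1[); [by left|right; split=> //].
    by move: tI xw; rewrite in_itv/= /xi; case: ifP.
  case=> [[xw _]|[tI wE]]; first exact: xw.
  by rewrite wE /xi; case: ifP.
apply: measurableU; first by rewrite one; exact: (xi_set (fun=> w) _).1.
apply: measurableI; first by apply: measurableC; exact: measurable_itv.
have [wE|wE] := pselect (w = [::]).
  by rewrite (_ : [set _ | _] = setT)//; apply/seteqP; split.
by rewrite (_ : [set _ | _] = set0)//; apply/seteqP; split.
Qed.

End offspring_existence.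

(** * Growing trees at a leaf *)

Section growing.
Context {K : nat}.
Variables (x : seq nat * 'I_K -> seq 'I_K) (i : 'I_K).
Hypothesis fx : tfinite x i.
Hypothesis inv : forall a, x a <> [::] -> grow x i a.1 = Some a.2.
Variables (u : seq nat) (j : 'I_K) (w : seq 'I_K).
Hypothesis gu : grow x i u = Some j.
Hypothesis xu : x (u, j) = [::].

Definition regrow a := if a == (u, j) then w else x a.

Let cons_neq (n : nat) (v : seq nat) : (n :: v == v) = false.
Proof. by apply/negbTE/eqP => /(congr1 size)/= /eqP; rewrite eqn_leq ltnn. Qed.

Let not_child n : grow x i (n :: u) = None.
Proof. by rewrite /= gu xu onth0n. Qed.

(** The vertices created at [u] were off the tree, so by [inv] their entries in [x] are empty and
    they stay childless. *)
Lemma grow_regrow v : grow regrow i v =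
  if v is n :: v' then if v' == u then onth w n else grow x i v else Some i.
Proof.
elim: v => [//|n v ih]; rewrite [LHS]/= ih.
case: eqVneq => [->|vu].
  have -> : (if u is n0 :: v' then if v' == u then onth w n0 else grow x i u else Some i)
      = Some j.
    case: u gu cons_neq => [//|m u'] gu' /(_ m u').
    by rewrite eq_sym => mu; rewrite {1}mu.
  by rewrite /regrow eqxx.
case: v vu ih => [|m v'] vu ih.
  by rewrite /regrow; case: eqP => [[uE]|//]; move: vu; rewrite -uE eqxx.
case: eqVneq => [v'u|v'u].
  rewrite v'u [grow x i (n :: m :: u)]/= -/(grow x i (m :: u)) not_child.
  case: (onth w m) => [j'|//]; rewrite /regrow.
  have -> : ((m :: u, j') == (u, j)) = false.
    by rewrite -pair_eqE /= cons_neq.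
  suff -> : x (m :: u, j') = [::] by rewrite onth0n.
  apply: contrapT => /inv; by rewrite not_child.
rewrite [in RHS]/= -/(grow x i (m :: v')); case: (grow x i (m :: v')) => [j'|//].
rewrite /regrow; case: eqP => [[uE]|//].
by move: vu; rewrite uE eqxx.
Qed.

Lemma tfinite_regrow : tfinite regrow i.
Proof.
apply: (@sub_finite_set _ _ [set` tverts x i ++ [seq n :: u | n <- iota 0 (size w)]]).
  move=> v /= /eqP; rewrite -/(grow _ _ _) grow_regrow mem_cat tvertsP//.
  case: v => [//|n v]; case: (eqVneq v u) => [->|_ ->//].
  move=> wn; apply/orP; right.
  by apply/mapP; exists n => //; rewrite mem_iota/= add0n -onthTE; case: onth wn.
exact: finite_seq.
Qed.

Lemma tverts_regrow :
  perm_eq (tverts regrow i) (tverts x i ++ [seq n :: u | n <- iota 0 (size w)]).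
Proof.
apply: uniq_perm; first exact: uniq_tverts.
  rewrite cat_uniq uniq_tverts map_inj_uniq ?iota_uniq ?andbT/=; last by move=> n m [].
  by apply/hasPn => _ /mapP[n _ ->]; rewrite tvertsP// not_child.
move=> v; rewrite (tvertsP _ tfinite_regrow) mem_cat tvertsP// grow_regrow.
case: v => [//|n v]; case: (eqVneq v u) => [->|vu].
  rewrite not_child/= mem_map; last by move=> ? ? [].
  by rewrite mem_iota/= add0n -onthTE; case: onth.
case: (grow x i (n :: v)) => //=.
by apply/esym/negbTE/negP => /mapP[m _ [_ vE]]; rewrite vE eqxx in vu.
Qed.

Lemma grow_regrow_old v : v \in tverts x i -> grow regrow i v = grow x i v.
Proof.
rewrite tvertsP// grow_regrow; case: v => [//|n v].
by case: (eqVneq v u) => [->|//]; rewrite not_child.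
Qed.

Lemma regrow_old v : v \in tverts x i ->
  regrow (key regrow i v) = if v == u then w else x (key x i v).
Proof.
move=> vx; rewrite /key /ttype grow_regrow_old//; move: vx; rewrite tvertsP//.
case E : (grow x i v) => [j'|//] _ /=; rewrite /regrow -pair_eqE/=.
by case: eqVneq => [vu|//] /=; move: E; rewrite vu gu => -[<-]; rewrite eqxx.
Qed.

Lemma ttype_new n : (n < size w)%N -> ttype regrow i (n :: u) = nth i w n.
Proof. by move=> nw; rewrite /ttype grow_regrow eqxx odflt_onth. Qed.

Lemma regrow_new n : (n < size w)%N -> regrow (key regrow i (n :: u)) = [::].
Proof.
move=> nw; rewrite /key /regrow -pair_eqE/= cons_neq/=.
by apply: contrapT => /inv/=; rewrite gu xu onth0n.
Qed.

Lemma regrow_inv a : regrow a <> [::] -> grow regrow i a.1 = Some a.2.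
Proof.
rewrite /regrow; case: eqP => [->/= _|_ /inv ga].
  by rewrite grow_regrow_old// tvertsP// gu.
by rewrite grow_regrow_old// tvertsP// ga.
Qed.

Let map_new (T : Type) (f : 'I_K -> T) :
  [seq f (nth i w n) | n <- iota 0 (size w)] = [seq f c | c <- w].
Proof.
by rewrite -[LHS]/(map (f \o nth i w) _) map_comp (map_nth_iota0 i (leqnn _)) take_size.
Qed.

Let mw : [seq nth i w n | n <- iota 0 (size w)] = w.
Proof. by rewrite (map_new id) map_id. Qed.

Lemma type_word_regrow : perm_eq (type_word regrow i) (type_word x i ++ w).
Proof.
rewrite /type_word (perm_trans (perm_map _ tverts_regrow))// map_cat.
rewrite (_ : [seq ttype regrow i v | v <- tverts x i] = [seq ttype x i v | v <- tverts x i]).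
  rewrite -map_comp perm_cat2l -[X in perm_eq _ X]map_id -(map_new id).
  rewrite (_ : map _ _ = [seq nth i w n | n <- iota 0 (size w)])//.
  by apply/eq_in_map => n; rewrite mem_iota/= => nw; exact: ttype_new.
by apply/eq_in_map => v vx; rewrite /ttype grow_regrow_old.
Qed.

(** At [u] the factor [z j [::]] is replaced by [z j w], and every new vertex is a leaf. The product
    form avoids dividing by [z j [::]]. *)
Lemma code_weight_regrow {R : realType} (z : 'I_K -> seq 'I_K -> R) :
  code_weight z (code regrow i) * z j [::] =
  code_weight z (code x i) * z j w * \prod_(c <- w) z c [::].
Proof.
have ux : u \in tverts x i by rewrite tvertsP// gu.
have tu : ttype x i u = j by rewrite /ttype gu.
rewrite /code_weight /code !big_map/= (perm_big _ tverts_regrow)/= big_cat/=.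
rewrite big_map.
have -> : \prod_(c <- w) z c [::] = \prod_(n <- iota 0 (size w)) z (nth i w n) [::].
  by rewrite -[in LHS]mw big_map.
have -> : \prod_(n <- iota 0 (size w)) z (ttype regrow i (n :: u)) (regrow (key regrow i (n :: u)))
    = \prod_(n <- iota 0 (size w)) z (nth i w n) [::].
  by apply: eq_big_seq => n; rewrite mem_iota/= => nw; rewrite ttype_new// regrow_new.
have -> : \prod_(v <- tverts x i) z (ttype regrow i v) (regrow (key regrow i v)) =
    \prod_(v <- tverts x i) z (ttype x i v) (if v == u then w else x (key x i v)).
  by apply: eq_big_seq => v vx; rewrite regrow_old// /ttype grow_regrow_old.
rewrite (bigD1_seq u)//= ?uniq_tverts// [in RHS](bigD1_seq u)//= ?uniq_tverts//.
rewrite eqxx tu /key tu xu.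
rewrite (eq_bigr (fun v => z (ttype x i v) (x (v, ttype x i v)))); first by ring.
by move=> v /negbTE ->.
Qed.

End growing.

Section leaves.
Context {K : nat}.
Implicit Types (x : seq nat * 'I_K -> seq 'I_K).

Definition leaves x i : seq 'I_K :=
  [seq ttype x i u | u <- tverts x i & x (key x i u) == [::]].

Lemma leaves_regrow x i u j w l :
  tfinite x i -> (forall a, x a <> [::] -> grow x i a.1 = Some a.2) ->
  grow x i u = Some j -> x (u, j) = [::] -> w != [::] ->
  perm_eq (leaves x i) (j :: l) -> perm_eq (leaves (regrow x u j w) i) (w ++ l).
Proof.
move=> fx inv gu xu w0 lx.
have ux : u \in tverts x i by rewrite tvertsP// gu.
have tu : ttype x i u = j by rewrite /ttype gu.
pose V := rem u (tverts x i).
have pV : perm_eq (tverts x i) (u :: V) := perm_to_rem ux.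
have uV : u \notin V by rewrite /V mem_rem_uniq ?uniq_tverts// inE eqxx.
pose l0 := [seq ttype x i v | v <- V & x (key x i v) == [::]].
have : perm_eq (j :: l0) (j :: l).
  apply: perm_trans lx; rewrite perm_sym.
  rewrite /leaves (perm_trans (perm_map _ (perm_filter _ pV)))//=.
  by rewrite /key tu xu eqxx/= tu.
rewrite perm_cons => l0l; rewrite perm_sym perm_catC perm_sym.
have p' := perm_trans (tverts_regrow fx inv w gu xu) (perm_cat pV (perm_refl _)).
rewrite /leaves (perm_trans (perm_map _ (perm_filter _ p')))//=.
rewrite regrow_old// eqxx (negbTE w0) filter_cat map_cat.
have VV v : v \in V -> v \in tverts x i by exact: mem_rem.
apply: perm_cat.
  apply: perm_trans l0l; rewrite /l0.
  rewrite (_ : [seq v <- V | regrow x u j w (key (regrow x u j w) i v) == [::]] =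
     [seq v <- V | x (key x i v) == [::]]); last first.
    apply: eq_in_filter => v vV; rewrite regrow_old ?VV//.
    by case: (eqVneq v u) => // vu; rewrite -vu vV in uV.
  rewrite (_ : map _ _ = [seq ttype (regrow x u j w) i v | v <- V & x (key x i v) == [::]])//.
  apply/eq_in_map => v; rewrite mem_filter => /andP[_ vV].
  by rewrite /ttype grow_regrow_old// VV.
rewrite (_ : seq.filter _ _ = [seq n :: u | n <- iota 0 (size w)]); last first.
  apply/all_filterP/allP => _ /mapP[n nw ->]; rewrite mem_iota/= in nw.
  by rewrite regrow_new.
rewrite -map_comp (_ : map _ _ = [seq nth i w n | n <- iota 0 (size w)]).
  by rewrite (map_nth_iota0 i (leqnn _)) take_size.
by apply/eq_in_map => n; rewrite mem_iota/= => nw; exact: ttype_new.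
Qed.

Lemma gsizeE (gamma : 'I_K -> nat) x i : tfinite x i ->
  gsize gamma (grow x i) = (\sum_(c <- type_word x i) gamma c)%N.
Proof.
move=> fx; rewrite /gsize; under eq_bigr do rewrite ntypeE//.
elim: (type_word x i) => [|c s ih]; first by rewrite big_nil big1// => j _; rewrite muln0.
rewrite big_cons -ih /=; under eq_bigr do rewrite mulnDr.
rewrite big_split/=; congr (_ + _)%N; rewrite (bigD1 c)//= eqxx muln1 big1 ?addn0//.
by move=> j; rewrite eq_sym => /negbTE ->; rewrite muln0.
Qed.

End leaves.

(** * Equivalent families are tilts *)

Section equivalence_ratio.
Context {R : realType} {K L : nat}.
Variables (Gamma : 'M[R]_(L, K)) (zeta zeta' : 'I_K -> seq 'I_K -> R).
Hypothesis pz : prob_family zeta.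
Hypothesis pz' : prob_family zeta'.
Hypothesis eqz : gamma_equivalent Gamma zeta zeta'.

Let z0 i w : 0 <= zeta i w. Proof. by case: pz. Qed.
Let z'0 i w : 0 <= zeta' i w. Proof. by case: pz'. Qed.

Definition type_counts x (i : 'I_K) : 'cV[R]_K := \col_j (ntype (grow x i) j)%:R.

Lemma code_weight_ge0 (z : 'I_K -> seq 'I_K -> R) s :
  (forall i w, 0 <= z i w) -> 0 <= code_weight z s.
Proof. by move=> zz; rewrite /code_weight prodr_ge0. Qed.

Let tree_law (z : 'I_K -> seq 'I_K -> R) d (Omega : measurableType d)
  (P : probability Omega R) xi x i : (forall i w, 0 <= z i w) ->
  offspring_family z P xi -> tfinite x i ->
  P (bgw xi i @^-1` (cond_set Gamma (Gamma *m type_counts x i) `&` [set grow x i])) =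
  (code_weight z (code x i))%:E.
Proof.
move=> zz xiP fx; rewrite (bgw_law xiP); last by move=> t [[]].
rewrite (_ : tree_codes _ _ = [set code x i]) ?esum_set1 ?lee_fin ?code_weight_ge0//.
apply/seteqP; split=> [s [y [_ yx] <-]|_ ->]; first exact: (code_tree yx).
by exists x => //; split.
Qed.

(** The conditional laws are compared at two single trees, which share the conditioning event and
    hence both normalising constants. *)
Lemma code_weight_ratio x y i : tfinite x i -> tfinite y i ->
  Gamma *m type_counts x i = Gamma *m type_counts y i ->
  0 < code_weight zeta (code x i) -> 0 < code_weight zeta (code y i) ->
  code_weight zeta' (code x i) * code_weight zeta (code y i) =
  code_weight zeta' (code y i) * code_weight zeta (code x i).
Proof.
move=> fx fy gxy wx wy; pose g := Gamma *m type_counts x i.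
have [d [Om [P [xi xiP]]]] := exists_offspring_family pz i.
have [d' [Om' [P' [xi' xi'P]]]] := exists_offspring_family pz' i.
have mC : measurable (bgw xi i @^-1` cond_set Gamma g).
  by apply: (bgw_measurable xiP) => t [].
have mT t : measurable (bgw xi i @^-1` (cond_set Gamma g `&` [set t])).
  by apply: (bgw_measurable xiP) => t' [[]].
have Pg : (0 < P (bgw xi i @^-1` cond_set Gamma g))%E.
  apply: (@lt_le_trans _ _ (P (bgw xi i @^-1` (cond_set Gamma g `&` [set grow x i])))).
    by rewrite (tree_law z0 xiP fx) lte_fin.
  by apply: le_measure; rewrite ?inE// => o [].
have [_ eqz2] := eqz.
have H t := eqz2 i g d d' Om Om' P P' xi xi' xiP xi'P Pg [set t].
have := H (grow y i); have := H (grow x i); rewrite /cond_law.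
have yP : P (bgw xi i @^-1` (cond_set Gamma g `&` [set grow y i])) =
    (code_weight zeta (code y i))%:E.
  by rewrite /g gxy; exact: (tree_law z0 xiP fy).
have yP' : P' (bgw xi' i @^-1` (cond_set Gamma g `&` [set grow y i])) =
    (code_weight zeta' (code y i))%:E.
  by rewrite /g gxy; exact: (tree_law z'0 xi'P fy).
rewrite yP yP' (tree_law z0 xiP fx) (tree_law z'0 xi'P fx)/=.
set Z := fine (P _); set Z' := fine (P' _) => Hx Hy.
have Z0 : 0 < Z by rewrite fine_gt0// Pg ltey_eq fin_num_measure.
(* Division by 0 returns 0, so [Z' = 0] would give the tree of [x] conditional probability 0, while
   it is positive under [zeta]. *)
have Z'0 : Z' != 0.
  apply/eqP => Z'0; move: Hx; rewrite Z'0 invr0 mulr0 => /eqP.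
  by rewrite mulf_eq0 invr_eq0 !gt_eqF.
have {}Hx : code_weight zeta' (code x i) = code_weight zeta (code x i) / Z * Z'.
  by rewrite Hx divfK.
have {}Hy : code_weight zeta' (code y i) = code_weight zeta (code y i) / Z * Z'.
  by rewrite Hy divfK.
by rewrite Hx Hy; ring.
Qed.

End equivalence_ratio.

(** * Trees with prescribed leaves *)

Section reach.
Context {R : realType} {K : nat}.
Variables (zeta zeta' : 'I_K -> seq 'I_K -> R) (gamma : 'I_K -> nat).
Hypothesis z0 : forall i w, 0 <= zeta i w.
Hypothesis znil : forall i, 0 < zeta i [::].
Hypothesis z'nil : forall i, zeta' i [::] != 0.

(* The last condition makes x empty off the tree, so that the vertices created
   by filling a leaf are themselves leaves. *)
Definition reach i (l : seq 'I_K) (n : nat) (r : R) := exists x,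
  [/\ tfinite x i, 0 < code_weight zeta (code x i), perm_eq (leaves x i) l,
      gsize gamma (grow x i) = n &
      code_weight zeta' (code x i) = r * code_weight zeta (code x i)] /\
  (forall a, x a <> [::] -> grow x i a.1 = Some a.2).

Definition wgamma (w : seq 'I_K) : nat := \sum_(c <- w) gamma c.

Definition ratio j (w : seq 'I_K) : R := zeta' j w / zeta j w.

(** The factor gained by the ratio of the [zeta']-weight to the [zeta]-weight of a tree when a leaf
    of type [j] receives the nonempty list of children [w]. *)
Definition move_ratio j w : R :=
  ratio j w / ratio j [::] * \prod_(c <- w) ratio c [::].

Lemma reach_perm i l l' n r : reach i l n r -> perm_eq l l' -> reach i l' n r.
Proof.
move=> [x [[fx wx lx nx rx] ix]] ll'; exists x; split=> //; split=> //.
exact: perm_trans ll'.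
Qed.

Lemma reach_root i : reach i [:: i] (gamma i) (ratio i [::]).
Proof.
pose x (a : seq nat * 'I_K) : seq 'I_K := [::].
have gx u : grow x i u = if u is [::] then Some i else None.
  by elim: u => [//|n v ih]; rewrite /= ih; case: v {ih} => [|m v]; rewrite ?onth0n.
have fx : tfinite x i.
  apply: (@sub_finite_set _ _ [set [::]]); last exact: finite_set1.
  by move=> u; rewrite /vertices/= gx; case: u.
have vx : perm_eq (tverts x i) [:: [::]].
  apply: uniq_perm => //; first exact: uniq_tverts.
  by move=> u; rewrite tvertsP// gx inE; case: u.
have vE : tverts x i = [:: [::]].
  by apply: perm_small_eq vx.
have cw z : code_weight z (code x i) = z i [::] :> R.
  by rewrite /code_weight /code vE/= big_seq1.
exists x; split=> //; split=> //.
- by rewrite cw.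
- by rewrite /leaves vE.
- by rewrite gsizeE// /type_word vE/= big_seq1.
- by rewrite !cw /ratio divfK// gt_eqF.
Qed.

Lemma reach_move i j l n r w : reach i (j :: l) n r -> w != [::] -> 0 < zeta j w ->
  reach i (w ++ l) (n + wgamma w) (r * move_ratio j w).
Proof.
move=> [x [[fx wx lx nx rx] ix]] w0 zw.
have : j \in leaves x i by rewrite (perm_mem lx) mem_head.
move=> /mapP[u]; rewrite mem_filter tvertsP// => /andP[/eqP + ux] jE.
rewrite /key -jE => xu; have gu : grow x i u = Some j.
  by move: jE ux; rewrite /ttype; case: grow => //= j' ->.
have fx' := tfinite_regrow fx ix w gu xu.
have pc : 0 < \prod_(c <- w) zeta c [::] by rewrite prodr_gt0.
exists (regrow x u j w); split; last exact: regrow_inv.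
have cwE := code_weight_regrow fx ix w gu xu.
have zx : code_weight zeta (code (regrow x u j w) i) =
    code_weight zeta (code x i) * zeta j w * \prod_(c <- w) zeta c [::] / zeta j [::].
  by rewrite -cwE mulfK// gt_eqF.
have z'x : code_weight zeta' (code (regrow x u j w) i) =
    code_weight zeta' (code x i) * zeta' j w * \prod_(c <- w) zeta' c [::] / zeta' j [::].
  by rewrite -cwE mulfK.
split=> //.
- by rewrite zx divr_gt0// !mulr_gt0.
- exact: leaves_regrow.
- rewrite gsizeE// (perm_big _ (type_word_regrow fx ix w gu xu))/= big_cat/=.
  by rewrite -gsizeE// nx.
- rewrite zx z'x rx /move_ratio /ratio.
  have -> : \prod_(c <- w) (zeta' c [::] / zeta c [::]) =
      (\prod_(c <- w) zeta' c [::]) / (\prod_(c <- w) zeta c [::]).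
    by rewrite -prodf_div.
  by field; rewrite z'nil !gt_eqF.
Qed.

Lemma reach_moves t i j l n r w : reach i (nseq t j ++ l) n r -> w != [::] ->
  0 < zeta j w -> exists l', reach i l' (n + t * wgamma w) (r * move_ratio j w ^+ t).
Proof.
move=> + w0 zw; elim: t l n r => [|t ih] l n r H.
  by exists l; rewrite mul0n addn0 expr0 mulr1.
have /ih[l' H'] : reach i (nseq t j ++ (w ++ l)) (n + wgamma w) (r * move_ratio j w).
  by apply: reach_perm (reach_move H w0 zw) _; rewrite perm_catCA.
by exists l'; rewrite mulSn addnA exprS mulrA.
Qed.

(** Filling a leaf of type [j] with [m > 1] letters [j] yields at least one more leaf of that type;
    the surplus goes into [l']. *)
Lemma reach_expand m j : (1 < m)%N -> 0 < zeta j (nseq m j) -> forall t i l n r,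
  reach i (j :: l) n r -> exists l' n' r', reach i (nseq t j ++ j :: l' ++ l) n' r'.
Proof.
move=> m1 zj; elim=> [|t ih] i l n r H; first by exists [::], n, r.
have [l' [n' [r' H']]] := ih _ _ _ _ H.
have H'' : reach i (j :: (nseq t j ++ l' ++ l)) n' r'.
  by apply: reach_perm H' _; rewrite -cat1s -[X in perm_eq _ X]cat1s perm_catCA.
have mN : nseq m j != [::] by case: m m1 {zj}.
have := reach_move H'' mN zj => {}H''.
exists (nseq m.-2 j ++ l'), (n' + wgamma (nseq m j))%N, (r' * move_ratio j (nseq m j)).
apply: reach_perm H'' _; case: m m1 {zj mN} => [//|[//|m]] _.
by apply/permP => p; rewrite /= !count_cat/= !count_cat !count_nseq; ring.
Qed.

(** A positive entry of a power of the mean matrix is a chain of words of positive weight, each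
    containing the next type; the leaf is filled along this chain and [l] stays untouched. *)
Lemma reach_path p i j k l n r :
  0 < (mean_mx zeta ^+ p) j k -> reach i (j :: l) n r ->
  exists l' n' r', reach i (k :: l' ++ l) n' r'.
Proof.
elim: p j l n r => [|p ih] j l n r.
  rewrite expr0 mxE; case: eqP => [->|]; last by rewrite ltxx.
  by move=> _ H; exists [::], n, r.
rewrite exprS => /mulmx_nneg_gt0[||j' [Mj Mk] H].
- exact: mean_mx_nneg.
- by apply: mx_nneg_exp; exact: mean_mx_nneg.
have [w zw j'w] := mean_mx_gt0_word z0 Mj.
have wN : w != [::] by case: w {zw} j'w.
have {}H : reach i (j' :: (rem j' w ++ l)) (n + wgamma w)%N (r * move_ratio j w).
  apply: reach_perm (reach_move H wN zw) _.
  by rewrite -cat_cons perm_cat2r perm_to_rem.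
have [l' [n' [r' {}H]]] := ih _ _ _ _ Mk H.
by exists (l' ++ rem j' w), n', r'; rewrite -catA.
Qed.

End reach.

Section tilt_of_equivalence.
Context {R : realType} {K L : nat}.
Variables (Gamma : 'M[R]_(L, K)) (zeta zeta' : 'I_K -> seq 'I_K -> R).
Variable gamma : 'I_K -> nat.
Hypothesis gamma_gt0 : forall i, (0 < gamma i)%N.
Hypothesis pz : prob_family zeta.
Hypothesis pz' : prob_family zeta'.
Hypothesis eqz : gamma_equivalent Gamma zeta zeta'.
Hypothesis znil : forall i, 0 < zeta i [::].
Hypothesis iz : irreducible zeta.
Hypothesis wz : forall j, exists2 m, (1 < m)%N & 0 < zeta j (nseq m j).
Hypothesis gammaP : forall x y i, tfinite x i -> tfinite y i ->
  gsize gamma (grow x i) = gsize gamma (grow y i) ->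
  Gamma *m type_counts x i = Gamma *m type_counts y i.

Let z0 i w : 0 <= zeta i w. Proof. by case: pz. Qed.
Let z'0 i w : 0 <= zeta' i w. Proof. by case: pz'. Qed.

Let z'_gt0 i w : 0 < zeta i w -> 0 < zeta' i w.
Proof.
have [supp _] := eqz; move=> zw; rewrite lt_def z'0 andbT; apply/eqP => /supp.
by move=> zw0; rewrite zw0 ltxx in zw.
Qed.

Let z'nil i : zeta' i [::] != 0. Proof. by rewrite gt_eqF// z'_gt0. Qed.

Let ratio_gt0 i w : 0 < zeta i w -> 0 < ratio zeta zeta' i w.
Proof. by move=> zw; rewrite divr_gt0// z'_gt0. Qed.

Let theta_gt0 i w : 0 < zeta i w -> 0 < move_ratio zeta zeta' i w.
Proof.
move=> zw; apply: mulr_gt0; first by apply: divr_gt0; exact: ratio_gt0.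
by rewrite prodr_gt0// => c _; exact: ratio_gt0.
Qed.

(** [gammaP] turns equal sizes into equal conditioning events, where the weight ratios must
    agree. *)
Let reach_inj i l l' n r r' : reach zeta zeta' gamma i l n r ->
  reach zeta zeta' gamma i l' n r' -> r = r'.
Proof.
move=> [x [[fx wx _ nx rx] _]] [y [[fy wy _ ny ry] _]].
have gxy := gammaP fx fy (etrans nx (esym ny)).
have := code_weight_ratio pz pz' eqz fx fy gxy wx wy; rewrite rx ry => H.
apply: (@mulIf _ (code_weight zeta (code x i) * code_weight zeta (code y i))).
  by rewrite mulf_neq0// gt_eqF.
by rewrite mulrA H; ring.
Qed.

Let code_weight_gt0 s : 0 < code_weight zeta s -> 0 < code_weight zeta' s.
Proof.
rewrite /code_weight; elim: s => [|p s ih]; first by rewrite !big_nil.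
rewrite !big_cons => H.
have p0 : 0 <= \prod_(q <- s) zeta q.1.2 q.2 by rewrite prodr_ge0.
have z_gt0 : 0 < zeta p.1.2 p.2.
  by rewrite lt_def z0 andbT; apply/eqP => zE; rewrite zE mul0r ltxx in H.
by rewrite mulr_gt0 ?z'_gt0// ih// -(pmulr_rgt0 _ z_gt0).
Qed.

(* Both sides are the change of the weight ratio when a leaf-rich tree grows
   by wgamma w * wgamma w', in two different ways. *)
Let theta_pow j w j' w' : 0 < zeta j w -> w != [::] -> 0 < zeta j' w' -> w' != [::] ->
  move_ratio zeta zeta' j w ^+ wgamma gamma w' =
  move_ratio zeta zeta' j' w' ^+ wgamma gamma w.
Proof.
move=> zw w0 zw' w'0; set s := wgamma gamma w; set s' := wgamma gamma w'.
have [m m1 zm] := wz j; have [m' m'1 zm'] := wz j'.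
have H0 := @reach_root R K zeta zeta' gamma znil j.
(* Two leaves of type [j]: one is spent on the path to [j'], the other is kept for copies of [w]. *)
have [l1 [n1 [r1 H1]]] := reach_expand znil z'nil m1 zm 1 H0.
have [p _ Mjj'] := iz j j'.
have {}H1 : reach zeta zeta' gamma j (j :: j :: l1) n1 r1.
  by apply: reach_perm H1 _; rewrite /= cats0.
have [l2 [n2 [r2 H2]]] := reach_path z0 znil z'nil Mjj' H1.
(* [s] leaves of type [j'] will take [s] copies of [w'], and [s'] leaves of type [j] will take [s']
   copies of [w]: either filling adds [s * s'] to gamma.N. *)
have [l3 [n3 [r3 H3]]] := reach_expand znil z'nil m'1 zm' s H2.
have {}H3 : reach zeta zeta' gamma j (j :: (nseq s j' ++ j' :: l3 ++ l2 ++ l1)) n3 r3.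
  apply: reach_perm H3 _; apply/permP => q.
  by rewrite /= !count_cat/= !count_cat/=; ring.
have [l4 [n4 [r4 H4]]] := reach_expand znil z'nil m1 zm s' H3.
set l := _ ++ _ in H4.
have [l5 H5] := reach_moves znil z'nil H4 w0 zw.
have {}H4 : reach zeta zeta' gamma j
    (nseq s j' ++ (nseq s' j ++ j :: l4 ++ j' :: l3 ++ l2 ++ l1)) n4 r4.
  by apply: reach_perm H4 _; rewrite /l -cat_cons catA perm_catCA -catA.
have [l6 H6] := reach_moves znil z'nil H4 w'0 zw'.
rewrite -/s' -/s in H5 H6; rewrite mulnC in H6.
have := reach_inj H5 H6; apply: mulfI.
case: H4 => x [[fx wx _ _ rx] _]; apply/eqP => r0.
by have := code_weight_gt0 wx; rewrite rx r0 mul0r ltxx.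
Qed.

(** Comparison with one fixed word [w0] shows that each factor [move_ratio] is [c] to the power
    [wgamma gamma w], where [c] is the root of order [s0] of the factor of [w0]. With [a j] the
    ratio at the empty word and [b j = c ^+ gamma j / a j], this is the tilt formula once
    [move_ratio] is unfolded. *)
Lemma tilt_of_equivalence : (0 < K)%N -> exists a b c,
  [/\ forall j, 0 < a j, forall j, 0 < b j, 0 < c,
      forall j w, zeta' j w = zeta j w * (a j * wprod b w) &
      forall j, a j * b j = c ^+ gamma j].
Proof.
move=> K0; pose j0 := Ordinal K0; have [m m1 zm] := wz j0.
pose w0 := nseq m j0; pose s0 := wgamma gamma w0.
have wg w : w != [::] -> (0 < wgamma gamma w)%N.
  by case: w => // c w _; rewrite /wgamma big_cons addn_gt0 gamma_gt0.
have w0N : w0 != [::] by rewrite /w0; case: m m1 {zm w0 s0}.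
have s0N : (s0%:R : R) != 0 by rewrite pnatr_eq0 -lt0n wg.
pose t0 := move_ratio zeta zeta' j0 w0; have t0_gt0 : 0 < t0 by exact: theta_gt0.
pose c := t0 `^ (s0%:R^-1).
have c0 : 0 < c by exact: powR_gt0.
have cs : c ^+ s0 = t0 by rewrite -powR_mulrn ?powR_ge0// -powRrM mulVf// powRr1// ltW.
have thetaE j w : 0 < zeta j w -> move_ratio zeta zeta' j w = c ^+ wgamma gamma w.
  move=> zw; have [->|wN] := eqVneq w [::].
    by rewrite /move_ratio /wgamma !big_nil expr0 mulr1 divff// gt_eqF// ratio_gt0.
  apply/eqP; rewrite -(eqrXn2 (wg _ w0N)) ?exprn_ge0 ?ltW ?theta_gt0//.
  by rewrite (theta_pow zw wN zm w0N) -/t0 -cs -!exprM mulnC.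
pose a j := ratio zeta zeta' j [::]; have a0 j : 0 < a j by exact: ratio_gt0.
exists a, (fun j => c ^+ gamma j / a j), c; split=> //.
- by move=> j; rewrite divr_gt0 ?exprn_gt0.
- move=> j w; have [/eqP zw|zw] := eqVneq (zeta j w) 0.
    have [supp _] := eqz; have /supp -> := eqP zw.
    by rewrite (eqP zw) mul0r.
  have zw0 : 0 < zeta j w by rewrite lt_def zw z0.
  have := thetaE j w zw0; rewrite /move_ratio => H.
  have pa : 0 < \prod_(c <- w) a c by rewrite prodr_gt0.
  have -> : wprod (fun j => c ^+ gamma j / a j) w =
      c ^+ wgamma gamma w / \prod_(c <- w) a c.
    by rewrite /wprod prodf_div prodrXr.
  rewrite -H -/(a j) -[\prod_(c <- w) ratio _ _ _ _]/(\prod_(c <- w) a c).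
  have -> : zeta' j w = zeta j w * ratio zeta zeta' j w.
    by rewrite /ratio mulrC divfK.
  by field; rewrite !gt_eqF.
- by move=> j; rewrite mulrC divfK// gt_eqF.
Qed.

End tilt_of_equivalence.

(** * Uniqueness of the critical tilt *)

Section uniqueness.
Context {R : realType} {K : nat}.
Implicit Types (z : 'I_K -> seq 'I_K -> R).

Lemma wprod_expR (y : 'I_K -> R) w : wprod (fun j => expR (y j)) w = expR (wsum y w).
Proof.
rewrite /wprod /wsum; elim: w => [|c w ih]; first by rewrite !big_nil expR0.
by rewrite !big_cons expRD ih.
Qed.

(* Gibbs' inequality, with its equality case. *)
Lemma mean_le_log_mass z1 z2 (y : 'cV[R]_K) (g : 'I_K -> R) :
  prob_family z1 -> prob_family z2 -> (forall i j, (mean z1 i j < +oo)%E) ->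
  (forall i w, z2 i w = z1 i w * expR (wsum (y ^~ 0) w - g i)) ->
  forall i, (mean_mx z1 *m y) i 0 <= g i /\
    ((mean_mx z1 *m y) i 0 = g i ->
     forall w, 0 < z1 i w -> wsum (y ^~ 0) w = g i).
Proof.
move=> [z10 z1m] [z20 z2m] mz zE i.
have s1 : rsummable (z1 i) by apply: rsummable_nneg => //; rewrite z1m ltry.
have s2 : rsummable (z2 i) by apply: rsummable_nneg => //; rewrite z2m ltry.
have m1 : rsum (z1 i) = 1 by apply: EFin_inj; rewrite -esum_rsum.
have m2 : rsum (z2 i) = 1 by apply: EFin_inj; rewrite -esum_rsum.
have sY := rsummable_mean z10 mz i (y ^~ 0).
(* [f] is [z1 (exp t - 1 - t)] with [t = wsum y w - g i]: nonnegative, and of sum [g i - (M y)_i]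
   because both masses are 1. *)
pose f w := z2 i w - (z1 i w + (z1 i w * wsum (y ^~ 0) w - g i * z1 i w)).
have sg := rsummableZ (g i) s1.
have sYg := rsummableB sY sg.
have sf : rsummable f by apply: rsummableB => //; exact: rsummableD.
have fE w : f w = z1 i w *
    (expR (wsum (y ^~ 0) w - g i) - (1 + (wsum (y ^~ 0) w - g i))).
  by rewrite /f zE; ring.
have f0 w : 0 <= f w by rewrite fE mulr_ge0// subr_ge0 expR_ge1Dx.
have rf : rsum f = g i - (mean_mx z1 *m y) i 0.
  rewrite rsumB//; last exact: rsummableD.
  by rewrite rsumD// rsumB// rsumZ// m1 m2 (mean_mx_mul z10 mz); ring.
split; first by rewrite -subr_ge0 -rf rsum_ge0.
move=> E w zw; have := rsum_eq0 f0 sf _ w; rewrite rf E subrr => /(_ erefl) fw0.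
apply: contrapT => /eqP; rewrite -subr_eq0 => sn0.
have := expR_gt1Dx sn0; rewrite -subr_gt0 => h.
by move: fw0; rewrite fE => /eqP; rewrite mulf_eq0 !gt_eqF.
Qed.

Lemma irreducible_mono z1 z2 : (forall i w, 0 <= z1 i w) -> (forall i w, 0 <= z2 i w) ->
  (forall i j, (mean z2 i j < +oo)%E) -> (forall i w, 0 < z1 i w -> 0 < z2 i w) ->
  irreducible z1 -> irreducible z2.
Proof.
move=> z10 z20 mz2 z12; apply: mx_irreducible_mono; try exact: mean_mx_nneg.
move=> i j /(mean_mx_gt0_word z10)[w zw jw].
exact: mean_mx_gt0 (z12 _ _ zw) jw.
Qed.

(** Pairing with the left Perron row [u] replaces [M y] by [y]: the nonnegative sum of the
    [u_i (g i - (M y)_i)] equals [- k] times the positive sum of the [u_i gamma_i]. If [k = 0] every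
    term vanishes and the equality case applies. *)
Lemma log_size_le0 z1 z2 (y : 'cV[R]_K) (g : 'I_K -> R) (gamma : 'I_K -> nat) k :
  (0 < K)%N -> (forall i, (0 < gamma i)%N) ->
  prob_family z1 -> prob_family z2 -> critical z1 -> irreducible z1 ->
  (forall i w, z2 i w = z1 i w * expR (wsum (y ^~ 0) w - g i)) ->
  (forall i, y i 0 - g i = k * (gamma i)%:R) ->
  k <= 0 /\ (k = 0 -> forall i w, 0 < z1 i w -> wsum (y ^~ 0) w = g i).
Proof.
move=> K0 gamma0 p1 p2 [mz r1] iz zE ykg; have [z10 _] := p1.
have [u u0 uM] := left_perron K0 (mean_mx_nneg z10) iz r1.
have H := mean_le_log_mass p1 p2 mz zE.
pose D i := g i - (mean_mx z1 *m y) i 0.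
have D0 i : 0 <= D i by rewrite subr_ge0; case: (H i).
have uD : \sum_i u 0 i * D i = - (k * \sum_i u 0 i * (gamma i)%:R).
  under eq_bigr do rewrite mulrBr.
  rewrite sumrB.
  have -> : \sum_i u 0 i * (mean_mx z1 *m y) i 0 = \sum_i u 0 i * y i 0.
    transitivity ((u *m mean_mx z1 *m y) 0 0); last by rewrite uM mxE.
    by rewrite -mulmxA mxE.
  rewrite -sumrB mulr_sumr -sumrN; apply: eq_bigr => i _.
  by rewrite mulrCA -ykg; ring.
have ug : 0 < \sum_i u 0 i * (gamma i)%:R.
  rewrite (bigD1 (Ordinal K0))//= ltr_pwDl ?mulr_gt0 ?ltr0n//.
  by rewrite sumr_ge0// => i _; rewrite mulr_ge0// ltW.
have uD0 : 0 <= \sum_i u 0 i * D i by rewrite sumr_ge0// => i _; rewrite mulr_ge0// ltW.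
split; first by move: uD0; rewrite uD oppr_ge0 pmulr_lle0.
move=> k0 i w zw; have [_ Hi] := H i; apply: Hi => //; apply/esym/eqP.
rewrite -subr_eq0 -/(D i).
have /eqP : \sum_i u 0 i * D i = 0 by rewrite uD k0 mul0r oppr0.
rewrite psumr_eq0; last by move=> j _; rewrite mulr_ge0// ltW.
move=> /allP/(_ i (mem_index_enum _)) /=.
by rewrite mulf_eq0 gt_eqF.
Qed.

Lemma critical_tilt_unique z z1 z2 (gamma : 'I_K -> nat) (a1 b1 a2 b2 : 'I_K -> R) c1 c2 :
  (0 < K)%N -> (forall i, (0 < gamma i)%N) ->
  (forall i w, 0 <= z i w) -> irreducible z -> (forall i, 0 < z i [::]) ->
  (forall j, exists2 m, (1 < m)%N & 0 < z j (nseq m j)) ->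
  prob_family z1 -> prob_family z2 -> critical z1 -> critical z2 ->
  [/\ forall j, 0 < a1 j, forall j, 0 < b1 j, 0 < c1,
      forall j w, z1 j w = z j w * (a1 j * wprod b1 w) &
      forall j, a1 j * b1 j = c1 ^+ gamma j] ->
  [/\ forall j, 0 < a2 j, forall j, 0 < b2 j, 0 < c2,
      forall j w, z2 j w = z j w * (a2 j * wprod b2 w) &
      forall j, a2 j * b2 j = c2 ^+ gamma j] ->
  z1 = z2.
Proof.
move=> K0 gamma0 z0 iz znil zw p1 p2 cr1 cr2 [a10 b10 c10 z1E ab1] [a20 b20 c20 z2E ab2].
(* Logarithms of the quotients of the parameters make [z2] an exponential multiple of [z1], and the
   relation [a * b = c ^+ gamma] becomes linear. *)
pose y : 'cV[R]_K := \col_j ln (b2 j / b1 j).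
pose g j := - ln (a2 j / a1 j).
pose k := ln (c2 / c1).
have supp (z' : 'I_K -> seq 'I_K -> R) a b : (forall j, 0 < a j) -> (forall j, 0 < b j) ->
    (forall j w, z' j w = z j w * (a j * wprod b w)) ->
    forall j w, 0 < z j w -> 0 < z' j w.
  by move=> a0 b0 zE j w h; rewrite zE !mulr_gt0// wprod_gt0.
have supp1 := supp z1 a1 b1 a10 b10 z1E; have supp2 := supp z2 a2 b2 a20 b20 z2E.
have iz1 : irreducible z1.
  by apply: irreducible_mono iz => //; [case: p1|case: cr1].
have iz2 : irreducible z2.
  by apply: irreducible_mono iz => //; [case: p2|case: cr2].
have ykg i : y i 0 - g i = k * (gamma i)%:R.
  rewrite mxE opprK -lnM ?posrE ?divr_gt0// mulr_natr -lnXn ?divr_gt0//.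
  by congr ln; rewrite expr_div_n -ab1 -ab2; field; rewrite !gt_eqF.
have wE w : wprod b2 w = wprod b1 w * expR (wsum (y ^~ 0) w).
  rewrite -wprod_expR -wprodM; congr wprod; apply/funext => j.
  by rewrite mxE lnK ?posrE ?divr_gt0// mulrC divfK// gt_eqF.
have aE j : a2 j = a1 j * expR (- g j).
  by rewrite /g opprK lnK ?posrE ?divr_gt0// mulrC divfK// gt_eqF.
have z12 i w : z2 i w = z1 i w * expR (wsum (y ^~ 0) w - g i).
  by rewrite z1E z2E wE aE expRD; ring.
have z21 i w : z1 i w = z2 i w * expR (wsum ((- y) ^~ 0) w - - g i).
  have -> : wsum ((- y) ^~ 0) w = - wsum (y ^~ 0) w.
    by rewrite /wsum -sumrN; apply: eq_bigr => j _; rewrite mxE.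
  by rewrite z12 -mulrA -expRD (_ : _ - _ + _ = 0) ?expR0 ?mulr1//; ring.
have [k_le0 Hk] := log_size_le0 K0 gamma0 p1 p2 cr1 iz1 z12 ykg.
have ykg' i : (- y) i 0 - - g i = - k * (gamma i)%:R.
  by rewrite mxE mulNr -ykg; ring.
have [k_ge0 _] := log_size_le0 K0 gamma0 p2 p1 cr2 iz2 z21 ykg'.
have {}Hk := Hk (le_anti (_ : k <= 0 <= k)).
have k0 : k = 0 by apply/le_anti; rewrite k_le0 -oppr_le0.
have Y i w : 0 < z i w -> wsum (y ^~ 0) w = g i.
  by move=> /supp1; apply: Hk; rewrite k_le0 -oppr_le0.
(* The empty word forces [g = 0]; then a word repeating a single letter forces [y = 0]. *)
have g0 i : g i = 0 by rewrite -(Y i [::])// /wsum big_nil.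
have y0 i : y i 0 = 0.
  have [m m1 zm] := zw i; have := Y i _ zm; rewrite g0 /wsum big_nseq iter_addr_0.
  by move=> /eqP; rewrite mulrn_eq0 => /orP[/eqP mE|/eqP//]; rewrite mE in m1.
apply/funext => i; apply/funext => w.
by rewrite z12 g0 /wsum big1 ?subr0 ?expR0 ?mulr1.
Qed.

End uniqueness.

(** * The row space in rank one *)

Section orthogonality.
Context {R : realType} {K L : nat}.
Variables (Gamma : 'M[R]_(L, K)) (gamma : 'I_K -> nat).
Hypothesis kG : ker_orthogonal Gamma (\col_j (gamma j)%:R).

Let gamma_row : 'rV[R]_K := \row_j (gamma j)%:R.

(** Orthogonality to the kernel puts [gamma] in the row space of [Gamma]. Being nonzero, it spans
    this space when the rank is 1, so [Gamma] factors through [gamma] and Gamma N is a function of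
    gamma.N. *)
Lemma rank1_gsize (i0 : 'I_K) : (0 < gamma i0)%N -> \rank Gamma = 1%N ->
  forall x y i, gsize gamma (grow x i) = gsize gamma (grow y i) ->
  Gamma *m type_counts x i = Gamma *m type_counts y i :> 'cV[R]_L.
Proof.
move=> gi0 rG x y i gxy.
have sub : (gamma_row <= Gamma)%MS.
  rewrite submxE; apply/eqP/rowP => k; rewrite [RHS]mxE mxE.
  have Gk : Gamma *m col k (cokermx Gamma) = 0 by rewrite colE mulmxA mulmx_coker mul0mx.
  by rewrite -[RHS](@kG _ Gk); apply: eq_bigr => j _; rewrite !mxE.
have rv : \rank gamma_row = 1%N.
  rewrite rank_rV; suff -> : gamma_row != 0 by [].
  by apply/rV0Pn; exists i0; rewrite mxE pnatr_eq0 -lt0n.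
have := mxrank_leqif_sup sub => -[_]; rewrite rv rG eqxx => /esym/submxP[D ->].
suff E t : gamma_row *m (\col_j (ntype t j)%:R) = (gsize gamma t)%:R%:M.
  by rewrite -!mulmxA !E gxy.
apply/matrixP => p q; rewrite !ord1 !mxE eqxx mulr1n /gsize natr_sum.
by apply: eq_bigr => j _; rewrite !mxE natrM.
Qed.

End orthogonality.

Theorem theorem4 (R : realType) (K : nat) (hK : (1 <= K)%N)
    (zeta : 'I_K -> seq 'I_K -> R) (hzeta : prob_family zeta)
    (A1 : entire zeta)
    (A2 : forall j : 'I_K, 0 < zeta j [::])
    (A3 : superlinear zeta)
    (L : nat) (hL : (1 <= L)%N) (Gamma : 'M[R]_(L, K))
    (B : exists gamma : 'I_K -> nat,
      [/\ ker_orthogonal Gamma (\col_j (gamma j)%:R),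
          forall j, (1 <= gamma j)%N &
          exists i, gamma i = 1%N]) :
  (exists zeta' : 'I_K -> seq 'I_K -> R,
     [/\ prob_family zeta', critical zeta' & gamma_equivalent Gamma zeta zeta'])
  /\
  (\rank Gamma = 1%N -> irreducible zeta ->
   exists! zeta' : 'I_K -> seq 'I_K -> R,
     [/\ prob_family zeta', critical zeta' & gamma_equivalent Gamma zeta zeta']).
Proof.
have [z0 _] := hzeta; have ez := entire_word_entire z0 A1.
have [gamma [kG gamma0 [i0 _]]] := B.
have ex : exists zeta' : 'I_K -> seq 'I_K -> R,
    [/\ prob_family zeta', critical zeta' & gamma_equivalent Gamma zeta zeta'].
  have [c [b [c0 b0 cb rho]]] := exists_critical_tilt hK z0 ez A2 A3 gamma0.
  exists (tilt zeta b); split.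
  - exact: tilt_prob.
  - split=> // i j; apply: word_entire_mean; first exact: tilt_ge0.
    exact: tilt_entire.
  have pb i : 0 < phi zeta i b by apply: phi_gt0 => // j; exact: ltW.
  apply: (tilt_gamma_equivalent (a := fun i => (phi zeta i b)^-1) (b := b)
    (c := c) (gamma := gamma)) => //.
  - by move=> j; rewrite invr_gt0.
  - by move=> j w; rewrite /tilt; ring.
  - by move=> j; rewrite -cb mulrC mulfK// gt_eqF.
split=> // rG iz; have [z1 [p1 cr1 e1]] := ex; exists z1; split=> // z2 [p2 cr2 e2].
have wz j := superlinear_word z0 ez A3 (A2 j).
have gP x y i (_ : tfinite x i) (_ : tfinite y i) :=
  @rank1_gsize _ _ _ Gamma gamma kG i0 (gamma0 i0) rG x y i.
have [a1 [b1 [c1 t1]]] := tilt_of_equivalence gamma0 hzeta p1 e1 A2 iz wz gP hK.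
have [a2 [b2 [c2 t2]]] := tilt_of_equivalence gamma0 hzeta p2 e2 A2 iz wz gP hK.
exact: critical_tilt_unique t1 t2.
Qed.
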